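(* Assume that $\infty$ is regular or an exit. Let $X=(X_t)_{t\ge0}$ be a Borel measurable $Q$-process on $(\Omega,\mathscr F,\mathbf P)$ and let $\bar X=(\bar X_t)_{t\ge0}$, realized on $(\Omega,\mathscr F,\mathbf P)$ with state space $\mathbf F$, be its Ray-Knight compactification constructed from the family $G=\{R_11_{\{i\}}:i\in\mathbb N\cup\{\partial\}\}\cup\{u_1\}$. Let $D$ be the set of non-branching points of $\bar X$. Then: (1) For every $t\ge0$, $\mathbf P(\bar X_t=X_t)=1$. (2) $\mathbb N\cup\{\partial\}\subset D$. (3) $\mathbf P$-a.s., $\bar X_t=X_t$ for a.e. $t$. (4) $\mathbf F=\mathbb N\cup\{\infty\}\cup\{\partial\}$, both as sets and as topological spaces, where $\mathbb N\cup\{\infty\}$ carries the topology of the Alexandroff compactification of the discrete space $\mathbb N$ and $\partial$ is an isolated point.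
   Context: Setting. $\mathbb N=\{0,1,2,\dots\}$. Let $a_0=0$, $a_k>0$ ($k\ge1$), $b_k>0$ ($k\ge 0$), $q_k=a_k+b_k$, and let $Q=(q_{ij})_{i,j\in\mathbb N}$ be the tridiagonal matrix with $q_{kk}=-q_k$, $q_{k,k+1}=b_k$, $q_{k,k-1}=a_k$, all other entries $0$. A transition matrix $(p_{ij}(t))_{i,j\in\mathbb N,t\ge0}$ is a nonnegative semigroup of matrices with row sums $\le 1$; it is extended to an honest one (row sums $1$) on $\mathbb N\cup\{\partial\}$ by adding a trap $\partial$. It is standard if $\lim_{t\to0}p_{ij}(t)=\delta_{ij}$. A $Q$-process is a continuous-time Markov chain whose transition matrix is standard with $p_{ij}'(0)=q_{ij}$ for all $i,j\in\mathbb N$. Its initial distribution is a probability measure on $\mathbb N$; it takes values in $\overline{\mathbb R}\cup\{\partial\}$ with $\mathbf P(X_t\in\mathbb N\cup\{\partial\})=1$ for each $t$. Processes are taken in Doob's canonical version (well-separable, Borel measurable in $(t,\omega)$, right lower semicontinuous). Put $\mu_0=1$, $\mu_k=\frac{b_0\cdots b_{k-1}}{a_1\cdots a_k}$, $c_0=0$, $c_1=\frac1{2b_0}$, $c_k=\frac1{2b_0}+\sum_{i=2}^k\frac{a_1\cdots a_{i-1}}{2b_0b_1\cdots b_{i-1}}$ ($k\ge2$), $\sigma=\sum_{k\ge0}(c_{k+1}-c_k)\sum_{i=0}^k\mu_i$, $\lambda=\sum_{k\ge0}c_k\mu_k$. The boundary $\infty$ is regular if $\sigma<\infty,\lambda<\infty$;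 an exit if $\sigma<\infty,\lambda=\infty$. Construction. $R_\alpha f(i)=\mathbf E_i\int_0^\infty e^{-\alpha t}f(X_t)dt$ is the resolvent on $\mathbb N\cup\{\partial\}$, acting on the class $\mathcal N_b^+$ of bounded nonnegative functions. Let $\eta_n=\inf\{t>0:X_t=n\}$, $\eta=\lim_n\eta_n$ (the first flying time; the process killed at $\eta$ is the minimal $Q$-process), $u_\alpha(i)=\mathbf E_ie^{-\alpha\eta}$ for $i\in\mathbb N$, $u_\alpha(\partial)=0$. The Ray cone $\mathcal S(G)$ is the unique minimal convex cone such that (i) $1_{\mathbb N\cup\{\partial\}}\in\mathcal S(G)$ and $G\subset\mathcal S(G)$; (ii) $\mathcal S(G)$ is separable in the uniform norm (there is a countable subset whose uniform closure in $\mathcal N_b^+$ contains $\mathcal S(G)$) and separates points of $\mathbb N\cup\{\partial\}$; (iii) $f\in\mathcal S(G)$ implies $R_\alpha f\in\mathcal S(G)$ for $\alpha>0$; (iv) $f,g\in\mathcal S(G)$ implies $f\wedge g\in\mathcal S(G)$. The Ray-Knight theorem yields a compact metric space $\mathbf F$ and a Ray resolvent $(\bar R_\alpha)$ on $\mathbf F$ such that: $\mathbb N\cup\{\partial\}$ is a dense Borel subset of $\mathbf F$; every $h\in\mathcal S(G)$ extends uniquely to $\bar h\in C(\mathbf F)$; $\overline{\mathcal S(G)}-\overline{\mathcal S(G)}$ is dense in $C(\mathbf F)$, where $\overline{\mathcal S(G)}=\{\bar h:h\in\mathcal S(G)\}$; and $\bar R_\alpha(i,A)=R_\alpha(i,A)$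 for $i\in\mathbb N\cup\{\partial\}$, $A\subset\mathbb N\cup\{\partial\}$. Moreover there is a càdlàg Ray process $\bar X$ on $\mathbf F$, realized on $(\Omega,\mathscr F,\mathbf P)$, with resolvent $(\bar R_\alpha)$ and $\mathbf P(\bar X_t=X_t)=1$ for a.e. $t$. This $\bar X$ is the Ray-Knight compactification of $X$. The set of non-branching points is $D=\{x\in\mathbf F:\alpha\bar R_\alpha f(x)\to f(x)\text{ as }\alpha\uparrow\infty,\ \forall f\in C(\mathbf F)\}$. *)

(* Defs.v *)
From HB Require Import structures.
From mathcomp Require Export all_boot all_order all_algebra.
From mathcomp Require Export all_classical all_reals all_analysis.
From mathcomp Require Export measurable_realfun.
Export Order.TTheory GRing.Theory Num.Theory.
Export numFieldNormedType.Exports.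

#[export] Set Implicit Arguments.
#[export] Unset Strict Implicit.
#[export] Unset Printing Implicit Defensive.

#[global] Open Scope classical_set_scope.
#[global] Open Scope ring_scope.

Section birth_death.
Context {R : realType}.
Implicit Types a b : nat -> R.

Definition birth_death_rates a b : Prop :=
  [/\ a 0%N = 0, forall k, (0 < k)%N -> 0 < a k & forall k, 0 < b k].

Definition bd_matrix a b (i j : nat) : R :=
  if j == i then - (a i + b i)
  else if j == i.+1 then b i
  else if i == j.+1 then a i
  else 0.

Definition bd_mu a b (k : nat) : R :=
  (\prod_(0 <= j < k) b j) / (\prod_(1 <= j < k.+1) a j).

(* For k = 1 the sum is empty, which leaves 1 / (2 b_0). *)
Definition bd_scale a b (k : nat) : R :=
  if k is 0%N then 0
  else (2 * b 0%N)^-1 +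
    \sum_(2 <= i < k.+1)
      (\prod_(1 <= j < i) a j) / (2 * \prod_(0 <= j < i) b j).

Definition bd_sigma a b : \bar R :=
  (\sum_(k <oo)
    ((bd_scale a b k.+1 - bd_scale a b k) * \sum_(i < k.+1) bd_mu a b i)%:E)%E.

Definition bd_lambda a b : \bar R :=
  (\sum_(k <oo) (bd_scale a b k * bd_mu a b k)%:E)%E.

Definition infty_regular a b : Prop :=
  (bd_sigma a b < +oo)%E /\ (bd_lambda a b < +oo)%E.

Definition infty_exit a b : Prop :=
  (bd_sigma a b < +oo)%E /\ bd_lambda a b = +oo%E.

End birth_death.

(* The state space N + {cemetery} is [option nat], the cemetery being [None]. *)

Section transition_matrix.
Context {R : realType}.
Implicit Types p : R -> nat -> nat -> R.

Record transition_matrix p : Prop := {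
  trans_ge0 : forall t i j, 0 <= t -> 0 <= p t i j ;
  trans_semigroup : forall s t i j, 0 <= s -> 0 <= t ->
    (p (s + t) i j)%:E = (\sum_(k <oo) (p s i k * p t k j)%:E)%E ;
  trans_le1 : forall t i, 0 <= t -> (\sum_(j <oo) (p t i j)%:E <= 1)%E }.

Definition standard p : Prop :=
  forall i j, p t i j @[t --> 0^'+] --> ((i == j)%:R : R).

Definition has_generator p (q : nat -> nat -> R) : Prop :=
  forall i j, (p t i j - p 0 i j) / t @[t --> 0^'+] --> q i j.

Definition honest_ext p (t : R) (x y : option nat) : R :=
  match x, y with
  | Some i, Some j => p t i j
  | Some i, None => 1 - fine (\sum_(j <oo) (p t i j)%:E)%E
  | None, Some _ => 0
  | None, None => 1
  end.

End transition_matrix.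

(* The value space, in which the cemetery [None] is an isolated point: its
   closed and measurable sets are the sets C with [Some @^-1` C] closed, resp.
   measurable.  (The topology that the library attaches to option types as
   one-point compactifications is not the one meant here.) *)
Definition ext_state (R : realType) : Type := option (\bar R).

Section processes.
Context {R : realType}.

Definition emb_state (x : option nat) : ext_state R :=
  omap (fun n : nat => n%:R%:E) x.

Definition ext_closed (C : set (ext_state R)) : Prop :=
  closed ((Some : \bar R -> ext_state R) @^-1` C).

Definition ext_measurable (C : set (ext_state R)) : Prop :=
  measurable ((Some : \bar R -> ext_state R) @^-1` C).

Definition ext_measurable_fun d (T : measurableType d) (D : set T)
    (f : T -> ext_state R) : Prop :=
  forall C, ext_measurable C -> measurable (D `&` f @^-1` C).

(* Functions on the state space, extended by 0; only used along processes that
   stay in the state space almost surely at each time. *)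
Definition on_states (f : option nat -> R) (x : ext_state R) : R :=
  if pselect (exists k, x = emb_state k) is left h then f (projT1 (cid h))
  else 0.

Context {d} {T : measurableType d}.
Implicit Types (P : probability T R) (X : R -> T -> ext_state R).

(* Markov chain (indexed by t >= 0) with transition matrix [honest_ext p] and
   initial distribution [init], through its finite-dimensional laws. *)
Record markov_chain P X (p : R -> nat -> nat -> R)
    (init : option nat -> \bar R) : Prop := {
  chain_measurable : forall t, 0 <= t -> ext_measurable_fun setT (X t) ;
  chain_states : forall t, 0 <= t ->
    P [set w | exists k, X t w = emb_state k] = 1%E ;
  chain_fidi : forall (n : nat) (t : nat -> R) (x : nat -> option nat),
    t 0%N = 0 -> (forall k, t k <= t k.+1) ->
    P [set w | forall k, (k <= n)%N -> X (t k) w = emb_state (x k)] =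
    (init (x 0%N) *
     (\prod_(k < n) honest_ext p (t k.+1 - t k) (x k) (x k.+1))%:E)%E }.

Definition init_nat (nu : probability nat R) (x : option nat) : \bar R :=
  if x is Some i then nu [set i] else 0%E.

Definition init_dirac (x0 x : option nat) : \bar R := ((x == x0)%:R : R)%:E.

Record Q_process (q : nat -> nat -> R) (p : R -> nat -> nat -> R) P X : Prop :=
 { Qp_trans : transition_matrix p ;
   Qp_standard : standard p ;
   Qp_generator : has_generator p q ;
   Qp_chain : exists nu : probability nat R, markov_chain P X p (init_nat nu) }.

Definition borel_process X : Prop :=
  ext_measurable_fun [set tw : R * T | 0 <= tw.1] (fun tw => X tw.1 tw.2).

(* Every countable dense S is a separating set: off one null set, for all open
   intervals ]a, b[ and all closed sets C, staying in C at the times of S in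
   the interval forces staying in C at all times of the interval. *)
Definition well_separable P X : Prop :=
  forall S : set R, countable S -> S `<=` [set t | 0 <= t] ->
    [set t | 0 <= t] `<=` closure S ->
    {ae P, forall w, forall (a b : R) (C : set (ext_state R)), ext_closed C ->
      (forall t, S t -> a < t < b -> C (X t w)) ->
      (forall t, 0 <= t -> a < t < b -> C (X t w))}.

(* x(t) = liminf_{s decreasing to t} x(s), the cemetery being isolated. *)
Definition right_lsc_at (x : R -> ext_state R) (t : R) : Prop :=
  match x t with
  | None => \forall s \near t^'+, x s = None
  | Some y => (\forall s \near t^'+, x s <> None) /\
      y = ereal_sup [set ereal_inf [set odflt 0%E (x s) | s in `]t, t + e[]
                    | e in [set e : R | 0 < e]]
  end.

Definition right_lsc P X : Prop :=
  {ae P, forall w, forall t, 0 <= t -> right_lsc_at (fun s => X s w) t}.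

Definition canonical_version P X : Prop :=
  [/\ well_separable P X, borel_process X & right_lsc P X].

End processes.

(* The expectations E_x, for x in N + {cemetery}, are taken under the measures
   [Px x] of a canonical realization [Y] of the chain started at each point. *)

Section markov_family.
Context {R : realType} {d} {T : measurableType d}.
Variables (Px : option nat -> probability T R) (Y : R -> T -> ext_state R).

Definition canonical_family (p : R -> nat -> nat -> R) : Prop :=
  forall x, markov_chain (Px x) Y p (init_dirac x) /\
            canonical_version (Px x) Y.

Definition chain_resolvent (alpha : R) (f : option nat -> R)
    (x : option nat) : R :=
  fine (\int[Px x]_w \int[lebesgue_measure]_(t in `[0%R, +oo[)
          (expR (- (alpha * t)) * on_states f (Y t w))%:E)%E.

Definition hitting_time (n : nat) (w : T) : \bar R :=
  ereal_inf [set t%:E | t in [set t : R | 0 < t /\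
                                Y t w = emb_state (Some n)]].

Definition flying_time (w : T) : \bar R :=
  lim (hitting_time n w @[n --> \oo]).

Definition u_fun (alpha : R) (x : option nat) : R :=
  if x is Some _ then
    fine (\int[Px x]_w expeR (- (alpha%:E * flying_time w)))%E
  else 0.

Definition generating_family : set (option nat -> R) :=
  [set f | exists x, f = chain_resolvent 1 (\1_[set x])] `|` [set u_fun 1].

End markov_family.

Section ray_cone.
Context {R : realType}.
Implicit Types (Res : R -> (option nat -> R) -> (option nat -> R)).
Implicit Types (G S : set (option nat -> R)).

Definition bounded_nonneg : set (option nat -> R) :=
  [set f | (forall x, 0 <= f x) /\ exists M, forall x, f x <= M].

Record ray_cone_axioms Res G S : Prop := {
  rc_sub : S `<=` bounded_nonneg ;
  rc_cone : forall (c c' : R) f g, 0 <= c -> 0 <= c' -> S f -> S g ->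
    S (fun x => c * f x + c' * g x) ;
  rc_one : S (fun=> 1) ;
  rc_gen : G `<=` S ;
  rc_separable : exists C, [/\ countable C, C `<=` S &
    forall f, S f -> forall e : R, 0 < e ->
      exists2 g, C g & forall x, `|f x - g x| <= e] ;
  rc_points : forall x y, x != y -> exists2 f, S f & f x != f y ;
  rc_resolvent : forall f (alpha : R), 0 < alpha -> S f -> S (Res alpha f) ;
  rc_min : forall f g, S f -> S g -> S (fun x => Num.min (f x) (g x)) }.

Definition is_ray_cone Res G S : Prop :=
  ray_cone_axioms Res G S /\
  forall S', ray_cone_axioms Res G S' -> S `<=` S'.

End ray_cone.

Definition borelType (F : ptopologicalType) := g_sigma_algebraType (@open F).

Section ray.
Context {R : realType} {F : pseudoPMetricType R}.
Local Notation B := (borelType F).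

Definition kint (k : B -> {measure set B -> \bar R}) (f : F -> R) (x : F) : R :=
  (\int[k x]_(y in [set: B]) (f y))%R.

Implicit Types Rbar : R -> R.-fker B ~> B.

Definition supermedian1 Rbar (f : F -> R) : Prop :=
  (forall x, 0 <= f x) /\
  forall alpha x, 0 < alpha -> alpha * kint (Rbar (alpha + 1)) f x <= f x.

Record ray_resolvent Rbar : Prop := {
  rr_submarkov : forall alpha (x : B), 0 < alpha ->
    (alpha%:E * Rbar alpha x setT <= 1)%E ;
  rr_equation : forall alpha beta (f : F -> R) x,
    0 < alpha -> 0 < beta -> continuous f ->
    kint (Rbar alpha) f x - kint (Rbar beta) f x =
    (beta - alpha) * kint (Rbar alpha) (kint (Rbar beta) f) x ;
  rr_continuous : forall alpha (f : F -> R),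
    0 < alpha -> continuous f -> continuous (kint (Rbar alpha) f) ;
  rr_points : forall x y : F, x != y ->
    exists f : F -> R, [/\ continuous f, supermedian1 Rbar f & f x != f y] }.

Definition nonbranching Rbar : set F :=
  [set x | forall f : F -> R, continuous f ->
     alpha * kint (Rbar alpha) f x @[alpha --> +oo] --> f x].

Record ray_semigroup Rbar (Pbar : R -> R.-spker B ~> B) : Prop := {
  rs_semigroup : forall s t (f : F -> R) x, 0 <= s -> 0 <= t -> continuous f ->
    kint (Pbar (s + t)) f x = kint (Pbar s) (kint (Pbar t) f) x ;
  rs_right_continuous : forall t (f : F -> R) x, 0 <= t -> continuous f ->
    kint (Pbar s) f x @[s --> t^'+] --> kint (Pbar t) f x ;
  rs_laplace : forall alpha (f : F -> R) x, 0 < alpha -> continuous f ->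
    kint (Rbar alpha) f x =
    (\int[lebesgue_measure]_(t in `[0%R, +oo[)
       (expR (- (alpha * t)) * kint (Pbar t) f x))%R }.

Definition cadlag (x : R -> F) : Prop :=
  (forall t, 0 <= t -> x s @[s --> t^'+] --> x t) /\
  (forall t, 0 < t -> exists l : F, x s @[s --> t^'-] --> l).

Context {d} {T : measurableType d}.

Definition natural_filtration (Xbar : R -> T -> F) (t : R) : set (set T) :=
  <<s [set E | exists s, exists2 A : set B,
         (0 <= s <= t) /\ measurable A & E = Xbar s @^-1` A] >>.

Definition markov_property (P : probability T R)
    (Pbar : R -> R.-spker B ~> B) (Xbar : R -> T -> F) : Prop :=
  forall s t (f : F -> R) E, 0 <= s -> 0 <= t -> continuous f ->
    natural_filtration Xbar t E ->
    (\int[P]_(w in E) (f (Xbar (t + s) w)) =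
     \int[P]_(w in E) (kint (Pbar s) f (Xbar t w)))%R.

Record ray_process Rbar (P : probability T R) (Xbar : R -> T -> F) : Prop := {
  rp_measurable : forall t, 0 <= t ->
    measurable_fun setT (Xbar t : T -> B) ;
  rp_cadlag : forall w, cadlag (fun t => Xbar t w) ;
  rp_markov : exists2 Pbar : R -> R.-spker B ~> B,
    ray_semigroup Rbar Pbar & markov_property P Pbar Xbar }.

(* [e] is the inclusion of N + {cemetery} into F. *)
Definition coincide (e : option nat -> F) (X : R -> T -> ext_state R)
    (Xbar : R -> T -> F) (t : R) : set T :=
  [set w | exists2 x, X t w = emb_state x & Xbar t w = e x].

(* A pseudometric space is a metric space precisely when it is Hausdorff. *)
Record ray_knight (Res : R -> (option nat -> R) -> (option nat -> R))
    (S : set (option nat -> R)) (P : probability T R)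
    (X : R -> T -> ext_state R)
    (e : option nat -> F) Rbar (Xbar : R -> T -> F) : Prop := {
  rk_metric : hausdorff_space F ;
  rk_compact : compact [set: F] ;
  rk_inj : injective e ;
  rk_dense : dense (range e) ;
  rk_borel : measurable (range e : set B) ;
  rk_ray : ray_resolvent Rbar ;
  rk_extend : forall h, S h ->
    exists! hbar : F -> R, continuous hbar /\ forall x, hbar (e x) = h x ;
  rk_diff_dense : forall f : F -> R, continuous f -> forall eps : R, 0 < eps ->
    exists g h : F -> R,
      [/\ continuous g /\ S (g \o e), continuous h /\ S (h \o e) &
          forall x, `|f x - (g x - h x)| < eps] ;
  rk_resolvent : forall alpha x (A : set (option nat)), 0 < alpha ->
    Rbar alpha (e x : B) (e @` A : set B) = (Res alpha (\1_A) x)%:E ;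
  rk_process : ray_process Rbar P Xbar ;
  rk_version : {ae (@lebesgue_measure R), forall t, 0 <= t ->
    P (coincide e X Xbar t) = 1%E} }.

(* F is the topological disjoint union of the Alexandroff compactification of
   the discrete space N and of the isolated point [e None], compatibly with
   the inclusion [e] of N + {cemetery}. *)
Definition alexandroff_plus_cemetery (e : option nat -> F) : Prop :=
  exists phi : one_point_compactification nat -> F,
    [/\ injective phi,
        forall n, phi (Some n) = e (Some n),
        range phi = ~` [set e None],
        forall U : set (one_point_compactification nat),
          open (phi @` U) <-> open U &
        open [set e None]].

End ray.

(* Main.v *)
Require Import Defs.
From mathcomp Require Import ring lra zify.

(* Since Q is conservative, r = R_alpha f satisfies |Q r| <= sup f on N for every
   bounded f >= 0, whatever the Q-process; in the natural scale this bounds the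
   increments of r by those of sigma, so r converges at infinity when
   sigma < oo.  Moreover, if g is the increasing solution of Q g = g with
   g(0) = 1, then discounted optional stopping along dyadic grids gives
   E_i exp(-eta_n) = g(i) / g(n) for i < n, so u_1(i) = g(i) / g(oo), which
   increases strictly to 1.  Hence the bounded nonnegative functions that
   converge at infinity satisfy the axioms of the Ray cone; by minimality every
   function of the cone converges along N, the sequence N has a single limit z
   in F, and u_1 separates z from N and from the cemetery.  This yields (4); in
   particular all states are isolated in F.  Part (2) follows from
   alpha R_alpha 1_x (x) -> 1; part (1) follows from the right continuity of
   the Ray process along good times decreasing to t, at which the chain sits
   at X_t with probability close to 1; part (3) is Fubini's theorem. *)

(** * Scale, speed measure and the increasing eigenfunction *)

(** The process is an arbitrary $Q$-process, possibly returning from infinity, so its transition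
    matrix is accessible only through its entries near time 0. Every estimate truncates a row to
    finitely many states: what lies outside has probability o(t) and can be bounded crudely. Hitting
    times are infima over uncountable sets of times. They are caught between two quantities read on
    dyadic grids: exp(-eta_n) is at least the discount at the dyadic visits to n and, by
    well-separability, at most the discount at the dyadic exits from {0, .., n-1}. Optional stopping
    on the grids bounds the first expectation from below and the second from above by the same
    number g(i) / g(n), so the three variables agree almost surely. This avoids both stopping times
    and the strong Markov property. The function u_1 has to be among the generators because
    resolvents alone need not detect the new point: for a process sent from infinity at once to a
    fixed state j, every resolvent has the same limit at infinity as its value at j. *)

Section birth_death_lemmas.
Context {R : realType} (a b : nat -> R).
Hypothesis rates : birth_death_rates a b.
Local Notation mu := (bd_mu a b).

Let a0 : a 0%N = 0. Proof. by case: rates. Qed.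
Let a_gt0 k : (0 < k)%N -> 0 < a k. Proof. by case: rates => _ + _; apply. Qed.
Let b_gt0 k : 0 < b k. Proof. by case: rates => _ _; apply. Qed.

Lemma bd_mu_gt0 k : 0 < mu k.
Proof.
rewrite /bd_mu divr_gt0//; first by apply: prodr_gt0 => i _.
by rewrite big_nat_cond prodr_gt0// => i /andP[/andP[i0 _] _]; exact: a_gt0.
Qed.

Lemma bd_mu0 : mu 0 = 1.
Proof. by rewrite /bd_mu !big_geq// divr1. Qed.

(** Detailed balance: [mu] is the reversing measure of the rates, the origin of the summation by
    parts below. *)
Lemma bd_mu_balance k : a k.+1 * mu k.+1 = b k * mu k.
Proof.
rewrite /bd_mu big_nat_recr//= (big_nat_recr k.+1)//=.
have := lt0r_neq0 (a_gt0 (ltn0Sn k)).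
have : \prod_(1 <= j < k.+1) a j != 0.
  rewrite lt0r_neq0// big_nat_cond prodr_gt0// => i /andP[/andP[i0 _] _].
  exact: a_gt0.
by move: (\prod_(1 <= j < k.+1) a j) (\prod_(0 <= j < k) b j) => x y y0 ak; field; rewrite y0 ak.
Qed.

(** The increments are the resistances [1 / (b k * mu k)] up to the factor 2 of the scale, which
    explains the constants [2 * M] and [expR (2 * C)] further on. *)
Lemma bd_scale_diff k :
  bd_scale a b k.+1 - bd_scale a b k = (2 * (b k * mu k))^-1.
Proof.
case: k => [|k]; first by rewrite /bd_scale subr0 big_geq// addr0 bd_mu0 mulr1.
rewrite {1 2}/bd_scale (big_nat_recr k.+2)//= opprD addrACA subrr add0r.
rewrite addrAC subrr add0r /bd_mu [\prod_(0 <= j < k.+2) b j]big_nat_recr//=.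
have b0 : \prod_(0 <= i < k.+1) b i != 0.
  by rewrite lt0r_neq0// prodr_gt0.
have := lt0r_neq0 (b_gt0 k.+1).
have : \prod_(1 <= j < k.+2) a j != 0.
  rewrite lt0r_neq0// big_nat_cond prodr_gt0// => i /andP[/andP[i0 _] _].
  exact: a_gt0.
move: b0; move: (\prod_(1 <= j < k.+2) a j) (\prod_(0 <= i < k.+1) b i).
by move=> x y y0 x0 b0; field; rewrite x0 y0 b0.
Qed.

Let bmu_gt0 k : 0 < b k * mu k. Proof. by rewrite mulr_gt0 ?bd_mu_gt0. Qed.

Lemma bd_scale_lt k : 0 < bd_scale a b k.+1 - bd_scale a b k.
Proof. by rewrite bd_scale_diff invr_gt0 mulr_gt0. Qed.

Let mu_sum_gt0 k : 0 < \sum_(i < k.+1) mu i.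
Proof.
rewrite big_ord_recr/= ltr_wpDl ?bd_mu_gt0// sumr_ge0// => i _.
exact/ltW/bd_mu_gt0.
Qed.

(** Row [i] lives on [i.-1], [i] and [i.+1], so a truncation beyond [i.+1] keeps it whole. At
    [i = 0] the term in [i.-1] vanishes. *)
Lemma bd_matrix_sum N i (f : nat -> R) : (i.+1 < N)%N ->
  \sum_(j < N) bd_matrix a b i j * f j =
  b i * (f i.+1 - f i) - a i * (f i - f i.-1).
Proof.
move=> iN.
have -> : \sum_(j < N) bd_matrix a b i j * f j =
  \sum_(0 <= j < N) bd_matrix a b i j * f j by rewrite big_mkord.
rewrite (big_cat_nat _ (n := i.+2))//= [X in _ + X]big1_seq ?addr0; last first.
  move=> j; rewrite mem_index_iota => /andP[_ /andP[ij _]].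
  by rewrite /bd_matrix; do 3 (case: eqP => [?|_]; first lia); rewrite mul0r.
rewrite big_nat_recr//= big_nat_recr//=.
have -> : bd_matrix a b i i = - (a i + b i) by rewrite /bd_matrix eqxx.
have -> : bd_matrix a b i i.+1 = b i by rewrite /bd_matrix eqxx gtn_eqF.
case: i iN => [|i] iN /=; first by rewrite big_geq// a0; ring.
rewrite big_nat_recr//= big1_seq; last first.
  move=> j; rewrite mem_index_iota => /andP[_ /= ji].
  by rewrite /bd_matrix; do 3 (case: eqP => [?|_]; first lia); rewrite mul0r.
have -> : bd_matrix a b i.+1 i = a i.+1.
  by rewrite /bd_matrix; do 2 (case: eqP => [?|_]; first lia); rewrite eqxx.
ring.
Qed.

(** By detailed balance, [mu k] times the generator at [k] is the increment of the flux
    [b k * mu k * (r k.+1 - r k)]; the sum telescopes, and nothing flows in at 0 because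
    [a 0 = 0]. *)
Lemma bd_flux (r : nat -> R) i :
  b i * mu i * (r i.+1 - r i) =
  \sum_(k < i.+1) mu k * \sum_(j < k.+2) bd_matrix a b k j * r j.
Proof.
elim: i => [|i IH].
  by rewrite big_ord_recr big_ord0/= bd_matrix_sum//= a0 bd_mu0; ring.
by rewrite big_ord_recr/= -IH bd_matrix_sum//= -(bd_mu_balance i); ring.
Qed.

Lemma bd_sigma_bound : (bd_sigma a b < +oo)%E -> exists2 C : R, 0 <= C &
  forall n, \sum_(k < n) (bd_scale a b k.+1 - bd_scale a b k) *
                         (\sum_(i < k.+1) mu i) <= C.
Proof.
move=> sfin.
have s_ge0 k : 0 <= (bd_scale a b k.+1 - bd_scale a b k) * (\sum_(i < k.+1) mu i).
  rewrite mulr_ge0 ?ltW ?bd_scale_lt// mu_sum_gt0.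
have sge0 : (0 <= bd_sigma a b)%E by apply: nneseries_ge0 => k _ _; rewrite lee_fin.
have sE : bd_sigma a b \is a fin_num by rewrite ge0_fin_numE.
exists (fine (bd_sigma a b)) => [|n]; first exact: fine_ge0.
rewrite -lee_fin fineK// -sumEFin.
have := @nneseries_lim_ge R (fun k => ((bd_scale a b k.+1 - bd_scale a b k) * (\sum_(i < k.+1) mu i))%:E) xpredT 0 n.
by rewrite big_mkord; apply => k _ _; rewrite lee_fin.
Qed.

Lemma telescope_bounded_cvg (r s : nat -> R) (C : R) :
  (forall k, `|r k.+1 - r k| <= s k) -> (forall n, \sum_(k < n) s k <= C) ->
  cvgn r.
Proof.
move=> rs sC.
have -> : r = (fun n => r 0%N + series (telescope r) n).
  by apply/funext => n; rewrite -eq_sum_telescope.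
apply: is_cvgD; first exact: is_cvg_cst.
apply: normed_cvg; apply: nondecreasing_is_cvgn.
  by apply/nondecreasing_seqP => n; rewrite -subr_ge0 seriesSB normr_ge0.
exists C => _ [n _ <-]; rewrite /normed_series_of seriesEord/=.
by apply: le_trans (sC n); apply: ler_sum => i _; exact: rs.
Qed.

(** The flux identity bounds the increment of [r] at [i] by [M] times the sum of [mu] up to [i],
    divided by [b i * mu i]. This is [2 * M] times the term of index [i] in sigma. *)
Lemma bd_bounded_generator_cvg (M : R) (r : nat -> R) :
  (bd_sigma a b < +oo)%E ->
  (forall i, `|\sum_(j < i.+2) bd_matrix a b i j * r j| <= M) -> cvgn r.
Proof.
move=> /bd_sigma_bound[C C0 sC] rM.
have M0 : 0 <= M by apply: le_trans (rM 0%N).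
apply: (@telescope_bounded_cvg r (fun k => 2 * M * ((bd_scale a b k.+1 - bd_scale a b k) *
                         (\sum_(i < k.+1) mu i))) (2 * M * C)) => [i|n]; last first.
  by rewrite -mulr_sumr ler_wpM2l// mulr_ge0.
rewrite bd_scale_diff -(ler_pM2l (bmu_gt0 i)) -{1}(gtr0_norm (bmu_gt0 i)) -normrM bd_flux.
rewrite (le_trans (ler_norm_sum _ _ _))//.
rewrite (_ : _ * (2 * M * _) = \sum_(k < i.+1) mu k * M); last first.
  by rewrite -mulr_suml; field; rewrite !gt_eqF// ?bd_mu_gt0.
apply: ler_sum => k _; rewrite normrM ler_pM//.
by rewrite gtr0_norm// bd_mu_gt0.
Qed.

(* The positive solution [g] of [Q g = g] with [g 0 = 1], paired with
   [\sum_(k <= i) mu_k g_k]. *)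
Fixpoint bd_eigen_flux (i : nat) : R * R :=
  if i is j.+1 then
    let: (g, t) := bd_eigen_flux j in
    let g' := g + t / (b j * mu j) in (g', t + mu j.+1 * g')
  else (1, 1).

Definition bd_eigen i : R := (bd_eigen_flux i).1.

Lemma bd_eigen_fluxE i :
  (bd_eigen_flux i).2 = \sum_(k < i.+1) mu k * bd_eigen k.
Proof.
elim: i => [|i IH]; first by rewrite big_ord_recr big_ord0/= bd_mu0 add0r mulr1.
rewrite big_ord_recr/= -IH /bd_eigen/=.
by case: (bd_eigen_flux i).
Qed.

(** The flux identity for an eigenfunction of eigenvalue 1, solved for its next value. *)
Lemma bd_eigenS i : bd_eigen i.+1 =
  bd_eigen i + (\sum_(k < i.+1) mu k * bd_eigen k) / (b i * mu i).
Proof. by rewrite -bd_eigen_fluxE /bd_eigen /=; case: (bd_eigen_flux i). Qed.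

Lemma bd_eigen_ge1 i : 1 <= bd_eigen i.
Proof.
elim/ltn_ind: i => -[//|i] IH; rewrite bd_eigenS (le_trans (IH i (ltnSn i)))//.
rewrite lerDl divr_ge0//; last exact/ltW.
rewrite sumr_ge0// => k _; rewrite mulr_ge0// ?ltW ?bd_mu_gt0//.
by rewrite (lt_le_trans _ (IH k _)).
Qed.

Lemma bd_eigen_gt0 i : 0 < bd_eigen i.
Proof. exact: lt_le_trans (bd_eigen_ge1 i). Qed.

Lemma bd_eigen_ltS i : bd_eigen i < bd_eigen i.+1.
Proof.
rewrite bd_eigenS ltrDl divr_gt0//.
have mug k : 0 < mu k * bd_eigen k.
  by apply: mulr_gt0; [exact: bd_mu_gt0 | exact: bd_eigen_gt0].
by rewrite big_ord_recr/= ltr_wpDl// sumr_ge0// => k _; exact/ltW.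
Qed.

Lemma bd_eigen_increasing : increasing_seq bd_eigen.
Proof. exact/increasing_seqP/bd_eigen_ltS. Qed.

Lemma bd_eigen_generator i N : (i.+1 < N)%N ->
  \sum_(j < N) bd_matrix a b i j * bd_eigen j = bd_eigen i.
Proof.
move=> iN; rewrite bd_matrix_sum//.
have mu0 k := lt0r_neq0 (bd_mu_gt0 k); have b0 k := lt0r_neq0 (b_gt0 k).
rewrite bd_eigenS [X in b i * X](_ : _ = (\sum_(k < i.+1) mu k * bd_eigen k) / (b i * mu i)); last by ring.
case: i {iN} => [|i] /=.
  by rewrite a0 mul0r subr0 big_ord_recr big_ord0/= bd_mu0; field.
rewrite big_ord_recr/=.
rewrite {2}bd_eigenS -(bd_mu_balance i).
by field; rewrite ?mu0 ?b0 ?lt0r_neq0// a_gt0.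
Qed.

(** A discrete Gronwall bound: as [bd_eigen] increases, its flux at [n] is at most [bd_eigen n]
    times the sum of [mu], so one step multiplies it by at most [1 + 2 * s n <= expR (2 * s n)]. *)
Lemma bd_eigen_cvg : (bd_sigma a b < +oo)%E -> cvgn bd_eigen.
Proof.
move=> /bd_sigma_bound[C C0 sC]; apply: nondecreasing_is_cvgn.
  by move=> m n mn; rewrite bd_eigen_increasing.
exists (expR (2 * C)) => _ [n _ <-].
pose s k := (bd_scale a b k.+1 - bd_scale a b k) * (\sum_(i < k.+1) mu i).
apply: (@le_trans _ _ (expR (2 * \sum_(k < n) s k))); last first.
  by rewrite ler_expR ler_pM2l.
elim: n => [|n IH]; first by rewrite big_ord0 mulr0 expR0.
rewrite big_ord_recr/= mulrDr expRD.
apply: (@le_trans _ _ (bd_eigen n * (1 + 2 * s n))); last first.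
  rewrite ler_pM ?expR_ge1Dx// ?ltW ?bd_eigen_gt0//.
  by rewrite addr_gt0// !mulr_gt0 ?bd_scale_lt ?mu_sum_gt0.
rewrite bd_eigenS mulrDr mulr1 lerD2l /s bd_scale_diff.
rewrite (_ : bd_eigen n * _ = (\sum_(k < n.+1) mu k * bd_eigen n) / (b n * mu n)); last first.
  by rewrite -mulr_suml; field; rewrite !lt0r_neq0// bd_mu_gt0.
rewrite ler_pM2r ?invr_gt0//.
apply: ler_sum => k _; rewrite ler_pM2l ?bd_mu_gt0//.
by rewrite bd_eigen_increasing -ltnS.
Qed.

End birth_death_lemmas.

(** * Marginals and two-time laws of the chain *)

Section states.
Context {R : realType}.

Lemma emb_state_inj : injective (@emb_state R).
Proof. by move=> [i|] [j|]//= [/eqP]; rewrite eqr_nat => /eqP ->. Qed.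

Lemma ext_measurable_state (x : option nat) : ext_measurable [set @emb_state R x].
Proof.
rewrite /ext_measurable; case: x => [n|].
  rewrite (_ : _ @^-1` _ = [set n%:R%:E]); first exact: emeasurable_set1.
  by apply/seteqP; split => [y /= [->]//|y /= ->].
rewrite (_ : _ @^-1` _ = set0); first exact: measurable0.
by apply/seteqP; split => [y|y].
Qed.

(** Enumerates all states, so that sums over them become series over [nat]; the cemetery gets index
    0. *)
Definition state_of_nat (k : nat) : option nat := if k is k'.+1 then Some k' else None.

Lemma state_of_nat_inj : injective state_of_nat.
Proof. by move=> [|i] [|j]//= [->]. Qed.

Lemma state_of_nat_surj x : exists k, state_of_nat k = x.
Proof. by case: x => [i|]; [exists i.+1|exists 0%N]. Qed.

Lemma on_statesE (f : option nat -> R) x : on_states f (emb_state x) = f x.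
Proof.
rewrite /on_states; case: pselect => [h|]; last by case; exists x.
by case: (cid h) => y /= /emb_state_inj ->.
Qed.

Lemma on_states_notin (f : option nat -> R) x :
  ~ (exists k, x = emb_state k) -> on_states f x = 0.
Proof. by rewrite /on_states; case: pselect. Qed.

Lemma on_states_ge0 (f : option nat -> R) x : (forall y, 0 <= f y) ->
  0 <= on_states f x.
Proof. by move=> f0; rewrite /on_states; case: pselect. Qed.

Lemma on_states_le (f : option nat -> R) x M : 0 <= M -> (forall y, f y <= M) ->
  on_states f x <= M.
Proof. by move=> M0 f0; rewrite /on_states; case: pselect. Qed.

End states.

Section transition_lemmas.
Context {R : realType} (p : R -> nat -> nat -> R).
Hypothesis Hp : transition_matrix p.

Lemma trans_sum_le1 t i N : 0 <= t -> \sum_(j < N) p t i j <= 1.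
Proof.
move=> t0; rewrite -lee_fin -sumEFin; apply: le_trans (trans_le1 Hp i t0).
have := @nneseries_lim_ge R (fun j => (p t i j)%:E) xpredT 0 N.
by rewrite big_mkord; apply => k _ _; rewrite lee_fin (trans_ge0 Hp).
Qed.

Lemma trans_row_ge0 t i : 0 <= t -> (0 <= \sum_(j <oo) (p t i j)%:E)%E.
Proof. by move=> t0; apply: nneseries_ge0 => k _ _; rewrite lee_fin (trans_ge0 Hp). Qed.

Lemma honest_ge0 t x y : 0 <= t -> 0 <= honest_ext p t x y.
Proof.
move=> t0; case: x => [i|]; case: y => [j|] //=; first exact: (trans_ge0 Hp).
rewrite subr_ge0 -lee_fin fineK ?(trans_le1 Hp)//.
rewrite ge0_fin_numE ?trans_row_ge0//.
by rewrite (le_lt_trans (trans_le1 Hp i t0))// ltry.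
Qed.

End transition_lemmas.

Section markov_chain_lemmas.
Context {R : realType} {d} {T : measurableType d}.
Context (P : probability T R) (X : R -> T -> ext_state R).
Context (p : R -> nat -> nat -> R) (init : option nat -> \bar R).
Hypothesis HX : markov_chain P X p init.
Hypothesis Hp : transition_matrix p.
Local Notation h := (honest_ext p).

Lemma chain_measurable_preimage t C : 0 <= t -> ext_measurable C ->
  measurable (X t @^-1` C).
Proof. by move=> t0 mC; rewrite -[X in measurable X]setTI; exact: (chain_measurable HX). Qed.

Lemma chain_measurable_at t x : 0 <= t ->
  measurable [set w | X t w = emb_state x].
Proof.
by move=> t0; apply: (chain_measurable_preimage t0 (ext_measurable_state x)).
Qed.

Lemma chain_statesE t : [set w | exists k, X t w = emb_state k] =
  \bigcup_k [set w | X t w = emb_state (state_of_nat k)].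
Proof.
apply/seteqP; split => [w [x /= Xx]|w [k _ /= Xk]].
  by have [k kx] := state_of_nat_surj x; exists k; rewrite //= kx.
by exists (state_of_nat k).
Qed.

Lemma chain_measurable_states t : 0 <= t ->
  measurable [set w | exists k, X t w = emb_state k].
Proof.
move=> t0; rewrite chain_statesE; apply: bigcup_measurable => k _.
exact: chain_measurable_at.
Qed.

Lemma chain_states_null t : 0 <= t ->
  P (~` [set w | exists k, X t w = emb_state k]) = 0%E.
Proof.
move=> t0; rewrite probability_setC ?(chain_states HX)// ?subee//.
exact: chain_measurable_states.
Qed.

Lemma chain_split t E : 0 <= t -> measurable E ->
  P E = (\sum_(k <oo) P (E `&` [set w | X t w = emb_state (state_of_nat k)]))%E.
Proof.
move=> t0 mE.
have mEk k : measurable (E `&` [set w | X t w = emb_state (state_of_nat k)]).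
  by apply: measurableI => //; exact: chain_measurable_at.
rewrite -measure_semi_bigcup//=; last 2 first.
- apply/trivIsetP => i j _ _ ij; apply/seteqP; split => [w|w]//=.
  by move=> [[_ ->]] [_ /emb_state_inj/state_of_nat_inj ji]; move: ij; rewrite ji eqxx.
- exact: bigcup_measurable.
rewrite -setI_bigcupr -chain_statesE.
have mS := chain_measurable_states t0.
rewrite -[in LHS](setUIDK E [set w | exists k, X t w = emb_state k]).
rewrite measureU//; last 3 first.
- exact: measurableI.
- exact: measurableD.
- by rewrite setDE setIACA setICr setI0.
rewrite [X in (_ + X)%E](_ : _ = 0%E) ?adde0//.
apply: (subset_measure0 _ _ _ (chain_states_null t0)) => //.
- exact: measurableD.
- exact: measurableC.
Qed.

(** Laws are prescribed only for trajectories observed from time 0 on, so the initial state has to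
    be summed out. *)
Lemma chain_marginal t y : 0 <= t -> P [set w | X t w = emb_state y] =
  (\sum_(k <oo) (init (state_of_nat k) * (h t (state_of_nat k) y)%:E))%E.
Proof.
move=> t0; rewrite (chain_split (lexx 0)); last exact: chain_measurable_at.
apply: eq_eseriesr => k _.
pose s := fun i : nat => if i is 0%N then 0 else t.
pose x := fun i : nat => if i is 0%N then state_of_nat k else y.
have /= := @chain_fidi _ _ _ _ _ _ _ HX 1%N (s) x erefl.
rewrite big_ord_recr big_ord0/= mul1r subr0 => <-; last by case.
congr (P _); apply/seteqP; split => [w /= [H1 H2] [|[|]]//|w /= H].
by split; [exact: (H 1%N)|exact: (H 0%N)].
Qed.

Lemma chain_two_times t s y z : 0 <= t -> 0 <= s ->
  P [set w | X t w = emb_state y /\ X (t + s) w = emb_state z] =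
  (P [set w | X t w = emb_state y] * (h s y z)%:E)%E.
Proof.
move=> t0 s0; rewrite chain_marginal//.
rewrite (chain_split (lexx 0)); last first.
  by apply: measurableI; apply: chain_measurable_at => //; rewrite addr_ge0.
(* [init] is a bare function; its values are nonnegative because the law at time 0 makes them
   probabilities. *)
have i0 k : (0 <= init k)%E.
  pose x := fun i : nat => k.
  have /= := @chain_fidi _ _ _ _ _ _ _ HX 0%N (fun=> 0) x erefl.
  by rewrite big_ord0 mule1 => <-.
rewrite muleC -nneseriesZl//; last first.
  by move=> k _; rewrite mule_ge0// lee_fin honest_ge0.
apply: eq_eseriesr => k _.
pose ti := fun i : nat => if i is 0%N then 0 else if i is 1%N then t else t + s.
pose x := fun i : nat => if i is 0%N then state_of_nat k else if i is 1%N then y else z.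
have /= := @chain_fidi _ _ _ _ _ _ _ HX 2%N (ti) x erefl.
rewrite !big_ord_recr big_ord0/= mul1r subr0 addrAC subrr add0r.
rewrite EFinM muleA muleC => <-.
  congr (P _); apply/seteqP; split => [w /= [[H1 H2] H3] [|[|[|]]]//|w /= H].
  by split; [split; [exact: (H 1%N)|exact: (H 2%N)]|exact: (H 0%N)].
by case => [|[|]]//=; rewrite lerDl.
Qed.

End markov_chain_lemmas.

(** * The resolvent *)

Section translation.
Context {R : realType}.
Local Notation leb := (@lebesgue_measure R).

Lemma integral_shift_itv (h : R) (f : R -> \bar R) :
  measurable_fun `[h, +oo[ f -> (forall t, h <= t -> (0 <= f t)%E) ->
  (\int[leb]_(t in `[h, +oo[) f t = \int[leb]_(t in `[0%R, +oo[) f (t + h)%R)%E.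
Proof.
move=> mf f0.
pose phi := (fun t : R => t + h) : measurableTypeR R -> measurableTypeR R.
have mphi : measurable_fun setT phi by apply: measurable_funD.
rewrite (eq_measure_integral (pushforward leb phi)); last first.
  (* Translation invariance, checked on half-open intervals. *)
  move=> A mA _; apply: lebesgue_measure_unique => // X -[[x y] /= _ <-].
  rewrite /pushforward (_ : phi @^-1` _ = `]x - h, y - h]%classic); last first.
    by apply/seteqP; split => t /=; rewrite !in_itv/= /phi; lra.
  rewrite !lebesgue_measure_itv/= !lte_fin ltrD2r; case: ifP => // _.
  by rewrite -!EFinB; congr EFin; ring.
rewrite ge0_integral_pushforward//=; last first.
  by move=> t; rewrite inE/= in_itv/= andbT => ?; exact: f0.
congr (integral _ _ _); apply/seteqP; split => t /=; rewrite /phi !in_itv/=; lra.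
Qed.

Lemma integral_exp_itv (alpha : R) : 0 < alpha ->
  (\int[leb]_(t in `[0%R, +oo[) (expR (- (alpha * t)))%:E = (alpha^-1)%:E)%E.
Proof.
move=> a0.
have : (\int[leb]_(t in `[0%R, +oo[) (alpha * expR (- (alpha * t)))%:E = 1)%E.
  rewrite integral_mkcond -(integral_exponential_pdf a0).
  apply: eq_integral => t _; rewrite /exponential_pdf !patchE.
  by case: ifP => //= _; rewrite mulNr.
under eq_integral do rewrite EFinM.
have mexp : measurable_fun (`[0, +oo[ : set R) (fun t : R => (expR (- (alpha * t)))%:E).
  apply/measurable_EFinP; apply: measurableT_comp => //.
  by apply: measurableT_comp => //; apply: measurable_funM.
rewrite ge0_integralZl_EFin//=; last exact: ltW.
move=> H; rewrite -[LHS]mul1e -(_ : (alpha^-1 * alpha)%:E = 1%E); last first.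
  by rewrite mulVf ?gt_eqF.
by rewrite EFinM -muleA H mule1.
Qed.

Lemma integral_exp_itvcc (alpha x : R) : 0 < alpha -> 0 < x ->
  (\int[leb]_(t in `[0%R, x]) (alpha * expR (- (alpha * t)))%:E =
   (1 - expR (- (alpha * x)))%:E)%E.
Proof.
move=> a0 x0; rewrite EFinB -mulNr -(exponential_prob_itv0c _ x0).
apply: eq_integral => t; rewrite inE/= in_itv/= => /andP[t0 _].
by rewrite exponential_pdfE// mulNr.
Qed.

End translation.

Lemma cvg_ord_sum {R : realType} {I : Type} (F : set_system I) {FF : Filter F}
    n (f : 'I_n -> I -> R) (l : 'I_n -> R) :
  (forall j, f j t @[t --> F] --> l j) ->
  \sum_j f j t @[t --> F] --> \sum_j l j.
Proof.
move=> fl; elim: (index_enum _) => [|j s IH].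
  by rewrite big_nil; under eq_fun do rewrite big_nil; exact: cvg_cst.
by rewrite big_cons; under eq_fun do rewrite big_cons; exact: cvgD.
Qed.

(** * Transition probabilities near time 0 *)

Section generator.
Context {R : realType} (a b : nat -> R) (p : R -> nat -> nat -> R).
Hypothesis rates : birth_death_rates a b.
Hypothesis Hs : standard p.
Hypothesis Hg : has_generator p (bd_matrix a b).

(** Standardness gives only the limit at 0, whereas [has_generator] subtracts the value at 0. A
    finite right derivative forces right continuity, so the two coincide. *)
Lemma trans_at0 i j : p 0 i j = (i == j)%:R.
Proof.
apply: (@cvg_unique _ _ (p t i j @[t --> 0^'+])) => //; last exact: Hs.
have : p 0 i j + t * ((p t i j - p 0 i j) / t) @[t --> 0^'+] --> p 0 i j + 0 * bd_matrix a b i j.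
  apply: cvgD; first exact: cvg_cst.
  by apply: cvgM; [exact: cvg_at_right_filter | exact: Hg].
rewrite mul0r addr0; apply: cvg_trans; apply: near_eq_cvg.
near=> t; have t0 : 0 < t by near: t; exact: nbhs_right_gt.
by rewrite mulrC divfK ?gt_eqF// addrC subrK.
Unshelve. all: by end_near. Qed.

Lemma trans_generator i j : (p t i j - (i == j)%:R) / t @[t --> 0^'+] --> bd_matrix a b i j.
Proof. by have := Hg (i:=i) (j:=j); rewrite trans_at0. Qed.

(** Only a finite truncation of the row is differentiated, so no exchange of limit and series
    arises. *)
Lemma trans_generator_apply N i (f : nat -> R) : (i.+1 < N)%N ->
  (\sum_(j < N) p t i j * f j - f i) / t @[t --> 0^'+] -->
  \sum_(j < N) bd_matrix a b i j * f j.
Proof.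
move=> iN.
rewrite (_ : (fun t => _) = (fun t => \sum_(j < N) ((p t i j - (i == j)%:R) / t) * f j)).
  by apply: cvg_ord_sum => j; apply: cvgM; [exact: trans_generator|exact: cvg_cst].
apply/funext => t.
have -> : f i = \sum_(j < N) (i == j :> nat)%:R * f j.
  rewrite (bigD1 (Ordinal (ltnW iN)))//= eqxx mul1r big1 ?addr0// => j.
  by rewrite -val_eqE/= eq_sym => /negbTE ->; rewrite mul0r.
by rewrite -sumrB mulr_suml; apply: eq_bigr => j _; ring.
Qed.

(** Rows of the matrix sum to 0, so the mass lost from the first [N] states within time [t] is o(t);
    this covers killing as well as long jumps. *)
Lemma trans_leave_cvg N i : (i.+1 < N)%N ->
  (1 - \sum_(j < N) p t i j) / t @[t --> 0^'+] --> 0.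
Proof.
move=> iN; have := @trans_generator_apply N i (fun=> 1) iN.
have /= -> := bd_matrix_sum rates (fun=> 1) iN.
rewrite !subrr !mulr0 subrr => /cvgN; rewrite oppr0.
apply: cvg_trans; apply: near_eq_cvg; near=> t.
rewrite fctE -mulNr opprB; congr ((_ - _) / _).
by apply: eq_bigr => j _; rewrite mulr1.
Unshelve. all: by end_near. Qed.

End generator.

(** * Expectations of functions of the chain *)

Section chain_expectation.
Context {R : realType} {d} {T : measurableType d}.
Context (P : probability T R) (X : R -> T -> ext_state R).
Context (p : R -> nat -> nat -> R) (init : option nat -> \bar R).
Hypothesis HX : markov_chain P X p init.

(** The states are countably many measurable points and [on_states f] is 0 on the remaining real
    values, so [f] may be arbitrary. *)
Lemma on_states_measurable_set (f : option nat -> R) (B : set R) :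
  ext_measurable (@on_states R f @^-1` B).
Proof.
rewrite /ext_measurable.
pose N := \bigcup_k [set (k%:R : R)%:E].
have mN : measurable N by apply: bigcup_measurable => k _; exact: emeasurable_set1.
rewrite (_ : _ @^-1` _ = (\bigcup_(k in [set k | B (f (Some k))]) [set (k%:R : R)%:E]) `|`
   (~` N `&` [set y | B 0])); last first.
  apply/seteqP; split => y /=.
    have [[k _ /= ->] By|nN By] := pselect (N y).
      left; exists k => //=.
      by move: By; rewrite (_ : Some _ = emb_state (Some k))// on_statesE.
    right; split => //; move: By; rewrite on_states_notin// => -[[k|]]//= [yk].
    by apply: nN; exists k.
  case=> [[k /= Bk ->]|[nN B0]].
    by rewrite (_ : Some _ = emb_state (Some k))// on_statesE.
  rewrite on_states_notin// => -[[k|]]//= [yk].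
  by apply: nN; exists k.
apply: measurableU.
  by apply: bigcup_measurable => k _; exact: emeasurable_set1.
apply: measurableI; first exact: measurableC.
have [B0|nB0] := pselect (B 0).
  by rewrite (_ : [set _ | _] = setT)//; apply/seteqP; split.
by rewrite (_ : [set _ | _] = set0)//; apply/seteqP; split.
Qed.

Lemma measurable_on_states d' (T' : measurableType d') (D : set T')
    (Z : T' -> ext_state R) f :
  ext_measurable_fun D Z -> measurable_fun D (fun w => on_states f (Z w)).
Proof.
by move=> mZ mD B mB; apply: (mZ (@on_states R f @^-1` B)); exact: on_states_measurable_set.
Qed.

Lemma integral_on_states t E (f : option nat -> R) : 0 <= t -> measurable E ->
  (forall x, 0 <= f x) ->
  (\int[P]_(w in E) (on_states f (X t w))%:E =
   \sum_(k <oo) (f (state_of_nat k))%:E *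
     P (E `&` [set w | X t w = emb_state (state_of_nat k)]))%E.
Proof.
move=> t0 mE f0.
have mEk k : measurable (E `&` [set w | X t w = emb_state (state_of_nat k)]).
  by apply: measurableI => //; exact: (chain_measurable_at HX).
have mf D : measurable_fun D (fun w => (on_states f (X t w))%:E).
  apply/measurable_EFinP; apply: (@measurable_funS _ _ _ _ setT) => //.
  exact/measurable_on_states/(chain_measurable HX).
have mS := chain_measurable_states HX t0.
rewrite -[in LHS](setUIDK E [set w | exists k, X t w = emb_state k]).
rewrite ge0_integral_setU//=; last 4 first.
- exact: measurableI.
- exact: measurableD.
- by move=> w _; rewrite lee_fin on_states_ge0.
- by apply/disj_set2P; rewrite setDE setIACA setICr setI0.
rewrite [X in (_ + X)%E](_ : _ = 0%E) ?adde0; last first.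
  apply: (null_set_integral) => //; first exact: measurableD.
  apply: (subset_measure0 _ _ _ (chain_states_null HX t0)) => //.
  - exact: measurableD.
  - exact: measurableC.
rewrite (chain_statesE X t) setI_bigcupr ge0_integral_bigcup//=; last 2 first.
- by move=> w _; rewrite lee_fin on_states_ge0.
- apply/trivIsetP => i j _ _ ij; apply/seteqP; split => [w|w]//=.
  by move=> [[_ ->]] [_ /emb_state_inj/state_of_nat_inj ji]; move: ij; rewrite ji eqxx.
apply: eq_eseriesr => k _.
rewrite -integral_cst//; apply: eq_integral => w; rewrite inE/= => -[_ ->].
by rewrite on_statesE.
Qed.

End chain_expectation.

Section resolvent.
Context {R : realType} (p : R -> nat -> nat -> R).
Context {d} {T : measurableType d}.
Context (Px : option nat -> probability T R) (Y : R -> T -> ext_state R).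
Hypothesis Hp : transition_matrix p.
Hypothesis famY : canonical_family Px Y p.
Local Notation leb := (@lebesgue_measure R).
Local Notation h := (honest_ext p).

Lemma family_chain x : markov_chain (Px x) Y p (init_dirac x).
Proof. by case: (famY x). Qed.

Lemma family_borel : borel_process Y.
Proof. by case: (famY None) => _ []. Qed.

Lemma family_marginal t x y : 0 <= t ->
  Px x [set w | Y t w = emb_state y] = (h t x y)%:E.
Proof.
move=> t0; rewrite (chain_marginal (family_chain x))//.
have [k0 <-] := state_of_nat_surj x.
rewrite (@nneseriesD1 _ _ k0)//=; last first.
  by move=> k _; rewrite mule_ge0 ?lee_fin ?honest_ge0 ?ler0n.
rewrite /init_dirac eqxx mul1e eseries0 ?adde0// => k _ /= kk0.
rewrite /init_dirac; case: eqP => [/state_of_nat_inj/eqP|_]; last by rewrite mul0e.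
by rewrite (negbTE kk0).
Qed.

Lemma family_two_times t s x y z : 0 <= t -> 0 <= s ->
  Px x [set w | Y t w = emb_state y /\ Y (t + s) w = emb_state z] =
  (h t x y * h s y z)%:E.
Proof.
by move=> t0 s0; rewrite (chain_two_times (family_chain x) Hp)// family_marginal.
Qed.

Definition chain_mean (f : option nat -> R) (t : R) (x : option nat) : R :=
  fine (\int[Px x]_w (on_states f (Y t w))%:E).

Section bounded.
Variables (f : option nat -> R) (M : R).
Hypothesis f0 : forall x, 0 <= f x.
Hypothesis fM : forall x, f x <= M.

Let M0 : 0 <= M. Proof. exact: le_trans (f0 None) (fM None). Qed.

Lemma measurable_chain_states t D : 0 <= t ->
  measurable_fun D (fun w => (on_states f (Y t w))%:E).
Proof.
move=> t0; apply/measurable_EFinP; apply: (@measurable_funS _ _ _ _ setT) => //.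
exact/measurable_on_states/(chain_measurable (family_chain None)).
Qed.

Lemma integral_chain_le t x A : 0 <= t -> measurable A ->
  (\int[Px x]_(w in A) (on_states f (Y t w))%:E <= M%:E * Px x A)%E.
Proof.
move=> t0 mA; rewrite -integral_cst//; apply: ge0_le_integral => //.
- by move=> w _; rewrite lee_fin on_states_ge0.
- exact: measurable_chain_states.
- by move=> w _; rewrite lee_fin on_states_le.
Qed.

Lemma chain_meanE t x : 0 <= t ->
  (\int[Px x]_w (on_states f (Y t w))%:E = (chain_mean f t x)%:E)%E.
Proof.
move=> t0; rewrite fineK// ge0_fin_numE; last first.
  by apply: integral_ge0 => w _; rewrite lee_fin on_states_ge0.
by rewrite (le_lt_trans (integral_chain_le x t0 measurableT))// probability_setT mule1 ltry.
Qed.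

Lemma chain_mean_ge0 t x : 0 <= chain_mean f t x.
Proof. by apply/fine_ge0/integral_ge0 => w _; rewrite lee_fin on_states_ge0. Qed.

Lemma chain_mean_le t x : 0 <= t -> chain_mean f t x <= M.
Proof.
move=> t0; rewrite -lee_fin -chain_meanE//.
by have := integral_chain_le x t0 measurableT; rewrite probability_setT mule1.
Qed.

(** Split according to the position at time [s]: the first [N] states contribute the sum exactly,
    and any other position, cemetery included, contributes between 0 and [M] times its
    probability. *)
Lemma chain_mean_markov (N i : nat) s t : 0 <= s -> 0 <= t ->
  0 <= chain_mean f (s + t) (Some i) -
       \sum_(j < N) p s i j * chain_mean f t (Some (j : nat))
    <= M * (1 - \sum_(j < N) p s i j).
Proof.
move=> s0 t0; have st0 : 0 <= s + t by exact: addr_ge0.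
pose E (j : 'I_N) := [set w | Y s w = emb_state (Some (j : nat))].
have mE j : measurable (E j) by exact: (chain_measurable_at (family_chain None)).
have tE : trivIset setT E.
  apply/trivIsetP => i' j _ _ ij; apply/seteqP; split => [w|w]//=.
  case=> Ei Ej; have := @emb_state_inj R (Some (i' : nat)) (Some (j : nat)) (etrans (esym Ei) Ej).
  by case=> /val_inj ji; move: ij; rewrite ji eqxx.
pose A := \big[setU/set0]_(j < N) E j.
have mA : measurable A by apply: bigsetU_measurable.
have intA : (\int[Px (Some i)]_(w in A) (on_states f (Y (s + t) w))%:E =
    (\sum_(j < N) p s i j * chain_mean f t (Some (j : nat)))%:E)%E.
  rewrite ge0_integral_bigsetU//=; last 4 first.
  - exact: index_enum_uniq.
  - exact: sub_trivIset tE.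
  - exact: measurable_chain_states.
  - by move=> w _; rewrite lee_fin on_states_ge0.
  rewrite -sumEFin; apply: eq_bigr => j _.
  rewrite (integral_on_states (family_chain _))//.
  have p0 := trans_ge0 Hp i j s0.
  rewrite EFinM -chain_meanE// (integral_on_states (family_chain _))//.
  rewrite -nneseriesZl; last by move=> k _; rewrite mule_ge0 ?lee_fin.
  apply: eq_eseriesr => k _.
  have -> := family_two_times (Some i) (Some (j : nat)) (state_of_nat k) s0 t0.
  by rewrite setTI family_marginal//= EFinM muleCA.
have PA : Px (Some i) A = (\sum_(j < N) p s i j)%:E.
  rewrite measure_semi_additive_ord// -sumEFin; apply: eq_bigr => j _.
  exact: (family_marginal (Some i) (Some (j : nat)) s0).
have mean : (\int[Px (Some i)]_w (on_states f (Y (s + t) w))%:E =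
  \int[Px (Some i)]_(w in A) (on_states f (Y (s + t) w))%:E +
  \int[Px (Some i)]_(w in ~` A) (on_states f (Y (s + t) w))%:E)%E.
  rewrite -(setUv A) ge0_integral_setU//=.
  - exact: measurableC.
  - exact: measurable_chain_states.
  - by move=> w _; rewrite lee_fin on_states_ge0.
  - by apply/disj_set2P; rewrite setICr.
have r0 : (0 <= \int[Px (Some i)]_(w in ~` A) (on_states f (Y (s + t) w))%:E)%E.
  by apply: integral_ge0 => w _; rewrite lee_fin on_states_ge0.
have rM := integral_chain_le (Some i) st0 (measurableC mA).
rewrite probability_setC// PA -EFinB -EFinM in rM.
move: mean r0 rM; rewrite chain_meanE// intA.
case: (\int[_]_(w in ~` A) _)%E => [r| |]//=.
by rewrite -EFinD !lee_fin => -[->] r0 rM; rewrite addrAC subrr add0r r0.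
Qed.

End bounded.
End resolvent.

(** * Time integrals and the resolvent over a short time step *)

Section resolvent_time.
Context {R : realType} (p : R -> nat -> nat -> R).
Context {d} {T : measurableType d}.
Context (Px : option nat -> probability T R) (Y : R -> T -> ext_state R).
Hypothesis Hp : transition_matrix p.
Hypothesis famY : canonical_family Px Y p.
Local Notation leb := (@lebesgue_measure R).
Local Notation h := (honest_ext p).
Local Notation mean := (chain_mean Px Y).
Local Notation halfline := (`[0%R, +oo[%classic : set R).
Variables (f : option nat -> R) (M : R).
Hypothesis f0 : forall x, 0 <= f x.
Hypothesis fM : forall x, f x <= M.

Let discounted alpha (tw : measurableTypeR R * T) : \bar R :=
  (((fun tw : R * T => expR (- (alpha * tw.1)) * on_states f (Y tw.1 tw.2))
     \_ [set tw | 0 <= tw.1]) tw)%:E.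

Let mD0 : measurable [set tw : measurableTypeR R * T | 0 <= tw.1].
Proof.
rewrite (_ : [set _ | _] = fst @^-1` halfline).
  by rewrite -[X in measurable X]setTI; exact: measurable_fst.
by apply/seteqP; split => -[t w]/=; rewrite in_itv/= andbT.
Qed.

Let measurable_discounted alpha : measurable_fun setT (discounted alpha).
Proof.
apply/measurable_EFinP/(measurable_restrictT _ mD0); apply: measurable_funM.
  apply: measurableT_comp => //; apply: measurableT_comp => //.
  by apply: measurable_funM => //; apply: measurable_funTS; exact: measurable_fst.
exact: (@measurable_on_states R _ (measurableTypeR R * T)%type _ (fun tw => Y tw.1 tw.2) f (family_borel famY)).
Qed.

Let discounted_ge0 alpha tw : (0 <= discounted alpha tw)%E.
Proof.
rewrite /discounted patchE lee_fin; case: ifP => // _.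
by rewrite mulr_ge0 ?expR_ge0 ?on_states_ge0.
Qed.

Let discountedE alpha t x : (\int[Px x]_w discounted alpha (t, w))%E =
  (if 0 <= t then expR (- (alpha * t)) * mean f t x else 0)%:E.
Proof.
rewrite /discounted; case: ifPn => t0; last first.
  rewrite integral0_eq// => w _; rewrite patchE memNset//=; exact/negP.
rewrite EFinM -(chain_meanE famY f0 fM)//.
rewrite -ge0_integralZl_EFin//; last 2 first.
- by move=> w _; rewrite lee_fin on_states_ge0.
- exact: (measurable_chain_states famY).
by apply: eq_integral => w _; rewrite patchE mem_set.
Qed.

Lemma measurable_discounted_mean alpha x :
  measurable_fun halfline (fun t => (expR (- (alpha * t)) * mean f t x)%:E).
Proof.
have := measurable_fun_fubini_tonelli_F (m2 := Px x) (discounted alpha)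
  (measurable_discounted alpha) (discounted_ge0 alpha).
move/(@measurable_funTS _ _ _ _ halfline) => mF.
apply: eq_measurable_fun mF => t; rewrite inE/= in_itv/= andbT => t0.
by rewrite /fubini_F discountedE t0.
Qed.

(** Tonelli for [discounted], whose extension by 0 to negative times is jointly measurable because
    [Y] is a Borel process. *)
Lemma chain_resolvent_timeE alpha x : 
  chain_resolvent Px Y alpha f x =
  fine (\int[leb]_(t in halfline) (expR (- (alpha * t)) * mean f t x)%:E)%E.
Proof.
rewrite /chain_resolvent; congr fine.
have := fubini_tonelli (m1 := leb) (m2 := Px x) (discounted alpha)
  (measurable_discounted alpha) (discounted_ge0 alpha).
under eq_integral do rewrite discountedE.
move=> H; transitivity (\int[Px x]_y \int[leb]_x0 discounted alpha (x0, y))%E.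
  apply: eq_integral => w _; rewrite integral_mkcond; apply: eq_integral => t _.
  rewrite /discounted !patchE.
  have -> : (t \in halfline) = (0 <= t) by rewrite mem_setE in_itv/= andbT.
  have -> : ((t, w) \in [set tw : R * T | 0 <= tw.1]) = (0 <= t).
    by apply/idP/idP => [|t0]; [rewrite inE|rewrite inE].
  by case: ifP.
rewrite -H [RHS]integral_mkcond; apply: eq_integral => t _; rewrite patchE.
have -> : (t \in halfline) = (0 <= t) by rewrite mem_setE in_itv/= andbT.
by case: ifP.
Qed.

Section discount.
Variable alpha : R.
Hypothesis alpha_gt0 : 0 < alpha.

Let M0 : 0 <= M. Proof. exact: le_trans (f0 None) (fM None). Qed.

Let integrand_ge0 t x : 0 <= expR (- (alpha * t)) * mean f t x.
Proof. by rewrite mulr_ge0 ?expR_ge0// chain_mean_ge0. Qed.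

Lemma integral_discount_cst (c : R) : 0 <= c ->
  (\int[leb]_(t in halfline) (expR (- (alpha * t)) * c)%:E = (c / alpha)%:E)%E.
Proof.
move=> c0; under eq_integral do rewrite mulrC EFinM.
have mexp : measurable_fun halfline (fun t : R => (expR (- (alpha * t)))%:E).
  apply/measurable_EFinP; apply: measurableT_comp => //.
  by apply: measurableT_comp => //; apply: measurable_funM.
by rewrite ge0_integralZl_EFin//= integral_exp_itv.
Qed.

Let measurable_discount_cst (c : R) (D : set R) :
  measurable_fun D (fun t : R => (expR (- (alpha * t)) * c)%:E).
Proof.
apply/measurable_EFinP; apply: measurable_funM => //; apply: measurableT_comp => //.
by apply: measurableT_comp => //; apply: measurable_funM.
Qed.

Let discount_le x :
  (\int[leb]_(t in halfline) (expR (- (alpha * t)) * mean f t x)%:E <= (M / alpha)%:E)%E.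
Proof.
rewrite -integral_discount_cst//; apply: ge0_le_integral => //.
- by move=> t _; rewrite lee_fin.
- exact: measurable_discounted_mean.
- exact: measurable_discount_cst.
- move=> t /=; rewrite in_itv/= andbT => t0.
  by rewrite lee_fin ler_wpM2l ?expR_ge0// (chain_mean_le famY f0 fM).
Qed.

Lemma chain_resolventE x :
  (\int[leb]_(t in halfline) (expR (- (alpha * t)) * mean f t x)%:E =
   (chain_resolvent Px Y alpha f x)%:E)%E.
Proof.
rewrite chain_resolvent_timeE fineK// ge0_fin_numE.
  by rewrite (le_lt_trans (discount_le x))// ltry.
by apply: integral_ge0 => t _; rewrite lee_fin.
Qed.

Lemma chain_resolvent_ge0 x : 0 <= chain_resolvent Px Y alpha f x.
Proof.
by rewrite -lee_fin -chain_resolventE; apply: integral_ge0 => t _; rewrite lee_fin.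
Qed.

Lemma chain_resolvent_le x : alpha * chain_resolvent Px Y alpha f x <= M.
Proof.
by rewrite mulrC -ler_pdivlMr// -lee_fin -chain_resolventE discount_le.
Qed.

(** [I] is the part of the resolvent collected before time [s], where the discount is at most 1. *)
Lemma chain_resolvent_short (s : R) x : 0 <= s ->
  exists I, [/\ 0 <= I, I <= M * s &
   (\int[leb]_(t in `[s, +oo[) (expR (- (alpha * t)) * mean f t x)%:E =
   (chain_resolvent Px Y alpha f x - I)%:E)%E].
Proof.
move=> s0; rewrite le_eqVlt in s0; case/orP: s0 => [/eqP <-|s0].
  by exists 0; rewrite mulr0 subr0 chain_resolventE.
have split_ : halfline = `[0%R, s[ `|` `[s, +oo[.
  by rewrite -itv_bndbnd_setU// bnd_simp// ltW.
have mm := @measurable_discounted_mean alpha x.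
have := chain_resolventE x; rewrite [in LHS]split_.
rewrite ge0_integral_setU//=; last 3 first.
- by rewrite -split_.
- by move=> t _; rewrite lee_fin.
- by apply/disj_set2P/seteqP; split => // t/= []; rewrite !in_itv/=; lra.
set I1 := integral _ _ _; set I2 := integral _ _ _.
have I10 : (0 <= I1)%E by apply: integral_ge0 => t _; rewrite lee_fin.
have I20 : (0 <= I2)%E by apply: integral_ge0 => t _; rewrite lee_fin.
have I1M : (I1 <= (M * s)%:E)%E.
  apply: (@le_trans _ _ (\int[leb]_(t in `[0%R, s[) M%:E)%E); last first.
    by rewrite integral_cst//= lebesgue_measure_itv/= lte_fin s0 oppr0 adde0 EFinM.
  apply: ge0_le_integral => //.
  - by move=> t _; rewrite lee_fin.
  - apply: measurable_funS mm => //; first by rewrite split_; exact: subsetUl.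
  - move=> t /=; rewrite in_itv/= => /andP[t0 _].
    rewrite lee_fin -[leRHS]mul1r ler_pM ?expR_ge0 ?chain_mean_ge0//.
      by rewrite -expR0 ler_expR oppr_le0 mulr_ge0// ltW.
    by rewrite (chain_mean_le famY f0 fM).
move: I1 I10 I1M => [r| |]//= r0 rM; move: I2 I20 => [r'| |]//= r'0.
rewrite -EFinD => -[<-]; exists r; split => //.
by rewrite addrAC subrr add0r.
Qed.

Lemma chain_resolvent_step (N i : nat) (s : R) : 0 <= s ->
  exists I J, [/\ 0 <= I <= M * s,
    0 <= J <= M * (1 - \sum_(j < N) p s i j) / alpha &
    chain_resolvent Px Y alpha f (Some i) - I =
    expR (- (alpha * s)) *
    (\sum_(j < N) p s i j * chain_resolvent Px Y alpha f (Some (j : nat)) + J)].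
Proof.
move=> s0; have [I [I0 IM HI]] := chain_resolvent_short (Some i) s0.
pose rem := M * (1 - \sum_(j < N) p s i j).
have rem0 : 0 <= rem.
  by rewrite mulr_ge0// subr_ge0; exact: trans_sum_le1.
pose S t := \sum_(j < N) p s i j * mean f t (Some (j : nat)).
have S0 t : 0 <= S t.
  by apply: sumr_ge0 => j _; rewrite mulr_ge0 ?(trans_ge0 Hp)// chain_mean_ge0.
have intS : (\int[leb]_(t in halfline) (expR (- (alpha * t)) * S t)%:E =
  (\sum_(j < N) p s i j * chain_resolvent Px Y alpha f (Some (j : nat)))%:E)%E.
  under eq_integral.
    move=> t _; rewrite /S mulr_sumr -sumEFin.
    under eq_bigr do rewrite mulrCA EFinM.
    over.
  rewrite ge0_integral_sum//; last 2 first.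
  - by move=> j; apply: emeasurable_funM => //; exact: measurable_discounted_mean.
  - by move=> j t _; rewrite mule_ge0// lee_fin// (trans_ge0 Hp).
  rewrite -sumEFin; apply: eq_bigr => j _.
  rewrite ge0_integralZl_EFin ?(trans_ge0 Hp)//.
  - by rewrite chain_resolventE EFinM.
  - by move=> t _; rewrite lee_fin.
  - exact: measurable_discounted_mean.
have mS : measurable_fun halfline (fun t => (expR (- (alpha * t)) * S t)%:E).
  apply/measurable_EFinP.
  rewrite (_ : (fun t => _) = (fun t => \sum_(j < N) p s i j * (expR (- (alpha * t)) * mean f t (Some (j : nat))))).
    apply: measurable_sum => j; apply: measurable_funM => //.
    by apply/measurable_EFinP; exact: measurable_discounted_mean.
  by apply/funext => t; rewrite /S mulr_sumr; apply: eq_bigr => j _; rewrite mulrCA.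
have mshift : measurable_fun halfline
    (fun t => (expR (- (alpha * (t + s))) * mean f (t + s) (Some i))%:E).
  apply: (@measurable_comp _ _ _ _ _ _ halfline
    (fun t => (expR (- (alpha * t)) * mean f t (Some i))%:E) halfline (fun t => t + s)) => //.
  - by move=> _ [t /= + <-]; rewrite !in_itv/= !andbT => t0; exact: addr_ge0.
  - exact: measurable_discounted_mean.
  - exact: measurable_funD.
rewrite integral_shift_itv in HI; last 2 first.
- apply: measurable_funS (@measurable_discounted_mean alpha (Some i)) => //.
  by move=> t /=; rewrite !in_itv/= !andbT; exact: le_trans.
- by move=> t _; rewrite lee_fin.
have lo : ((expR (- (alpha * s)) * \sum_(j < N) p s i j * chain_resolvent Px Y alpha f (Some (j : nat)))%:E
   <= (chain_resolvent Px Y alpha f (Some i) - I)%:E)%E.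
  rewrite -HI EFinM -intS -ge0_integralZl_EFin ?expR_ge0//; last first.
    by move=> t _; rewrite lee_fin mulr_ge0 ?expR_ge0.
  apply: ge0_le_integral => //.
  - by move=> t _; rewrite -EFinM lee_fin !mulr_ge0 ?expR_ge0.
  - by apply: emeasurable_funM.
  - move=> t /=; rewrite in_itv/= andbT => t0.
    rewrite -EFinM lee_fin mulrA -expRD (_ : - (alpha * s) + - (alpha * t) = - (alpha * (t + s))); last by ring.
    rewrite ler_wpM2l ?expR_ge0// addrC -subr_ge0.
    by have /andP[] := chain_mean_markov Hp famY f0 fM N i s0 t0.
have hi : ((chain_resolvent Px Y alpha f (Some i) - I)%:E <=
   (expR (- (alpha * s)) * (\sum_(j < N) p s i j * chain_resolvent Px Y alpha f (Some (j : nat)) + rem / alpha))%:E)%E.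
  rewrite -HI EFinM EFinD -intS -integral_discount_cst// -ge0_integralD//; last 3 first.
  - by move=> t _; rewrite lee_fin mulr_ge0 ?expR_ge0.
  - by move=> t _; rewrite lee_fin mulr_ge0 ?expR_ge0.
  - exact: measurable_discount_cst.
  rewrite -ge0_integralZl_EFin ?expR_ge0//; last 2 first.
  - by move=> t _; rewrite -EFinD lee_fin addr_ge0// mulr_ge0 ?expR_ge0.
  - by apply: emeasurable_funD => //; exact: measurable_discount_cst.
  apply: ge0_le_integral => //.
  - by move=> t _; rewrite lee_fin.
  - by apply: emeasurable_funM => //; apply: emeasurable_funD => //; exact: measurable_discount_cst.
  - move=> t /=; rewrite in_itv/= andbT => t0.
    rewrite -EFinD -EFinM lee_fin -mulrDr mulrA -expRD (_ : - (alpha * s) + - (alpha * t) = - (alpha * (t + s))); last by ring.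
    rewrite ler_wpM2l ?expR_ge0// addrC -lerBlDl.
    by have /andP[] := chain_mean_markov Hp famY f0 fM N i s0 t0.
rewrite !lee_fin in lo hi.
set r := chain_resolvent _ _ _ _ (Some i) in lo hi *.
set Q := \sum_(j < N) _ in lo hi *.
(* [J] is obtained by solving the identity for it; [lo] and [hi] are then its two bounds. *)
exists I, ((r - I) * expR (alpha * s) - Q); split => //.
- by rewrite I0.
- have e1 : expR (- (alpha * s)) * expR (alpha * s) = 1 by rewrite -expRD addNr expR0.
  have e0 := expR_gt0 (alpha * s).
  have lo' := ler_wpM2r (ltW e0) lo; have hi' := ler_wpM2r (ltW e0) hi.
  rewrite mulrAC e1 mul1r in lo'; rewrite mulrAC e1 mul1r in hi'.
  by rewrite subr_ge0 lo' lerBlDl.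
- by rewrite [Q + _]addrC subrK mulrCA -expRD addNr expR0 mulr1.
Qed.

End discount.
End resolvent_time.

(** * Limits of resolvents at infinity in space and in the parameter *)

Section resolvent_limits.
Context {R : realType} (a b : nat -> R) (p : R -> nat -> nat -> R).
Context {d} {T : measurableType d}.
Context (Px : option nat -> probability T R) (Y : R -> T -> ext_state R).
Hypothesis rates : birth_death_rates a b.
Hypothesis Hp : transition_matrix p.
Hypothesis Hs : standard p.
Hypothesis Hg : has_generator p (bd_matrix a b).
Hypothesis famY : canonical_family Px Y p.
Local Notation h := (honest_ext p).

Section bounded.
Variables (f : option nat -> R) (M : R).
Hypothesis f0 : forall x, 0 <= f x.
Hypothesis fM : forall x, f x <= M.
Variable alpha : R.
Hypothesis alpha_gt0 : 0 < alpha.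

(* This is all that is kept of the backward equation [alpha r - Q r = f]: it is
   insensitive to [f], and conservativity of [Q] disposes of the jumps at
   distance more than one. *)
Lemma chain_resolvent_generator_bound i :
  `|\sum_(j < i.+2) bd_matrix a b i j * chain_resolvent Px Y alpha f (Some (j : nat))| <= M.
Proof.
have M0 : 0 <= M by exact: le_trans (f0 None) (fM None).
pose r (j : nat) := chain_resolvent Px Y alpha f (Some j).
have r0 j : 0 <= r j := chain_resolvent_ge0 famY f0 fM alpha_gt0 (Some j).
have rM j : alpha * r j <= M := chain_resolvent_le famY f0 fM alpha_gt0 (Some j).
have Sr := @trans_generator_apply _ _ _ _ Hs Hg i.+2 i r (ltnSn _).
have exp1 : expR (alpha * t) @[t --> 0^'+] --> (1 : R).
  rewrite -expR0 -[X in expR X](mulr0 alpha).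
  apply: cvg_at_right_filter; apply: continuous_comp; last exact: continuous_expR.
  by apply: cvgM; [exact: cvg_cst|exact: cvg_id].
(* The bounds on [I] and [J] give the lower estimate, which tends to [- M]. For the upper one, [I]
   and [J] are dropped and [1 - x <= expR (- x)] is used; its limit [alpha * r i] is at most [M]. *)
have step t : 0 < t ->
    - (expR (alpha * t) * M) - M / alpha * ((1 - \sum_(j < i.+2) p t i j) / t) <=
    (\sum_(j < i.+2) p t i j * r j - r i) / t <= alpha * r i * expR (alpha * t).
  move=> t0.
  have [I [J [/andP[I0 IM] /andP[J0 JM]]]] :=
    chain_resolvent_step Hp famY f0 fM alpha_gt0 i.+2 i (ltW t0).
  rewrite -/(r i); set S := \sum_(j < _) _; set s1 := \sum_(j < _) _ in JM *.
  rewrite -/S => E.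
  have e0 := expR_gt0 (alpha * t).
  have SE : S = expR (alpha * t) * (r i - I) - J.
    by rewrite E mulrA -expRD subrr expR0 mul1r addrK.
  have e1 : 1 <= expR (alpha * t).
    by rewrite -expR0 ler_expR mulr_ge0// ltW.
  apply/andP; split.
    rewrite ler_pdivlMr// SE.
    have -> : (- (expR (alpha * t) * M) - M / alpha * ((1 - s1) / t)) * t =
       - (expR (alpha * t) * (M * t)) - M * (1 - s1) / alpha.
      by field; rewrite !gt_eqF.
    have := ler_wpM2l (ltW e0) IM.
    have : r i <= expR (alpha * t) * r i by rewrite ler_peMl.
    rewrite mulrBr; lra.
  rewrite ler_pdivrMr// SE.
  have : expR (alpha * t) * (1 - alpha * t) <= 1.
    have := expR_ge1Dx (- (alpha * t)); rewrite expRN.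
    by rewrite -ler_pdivlMl// mulr1.
  move=> /(ler_wpM2r (r0 i)).
  have := mulr_ge0 (ltW e0) I0.
  rewrite !mulrBr !mulrBl; lra.
rewrite ler_norml; apply/andP; split.
- have : - (expR (alpha * t) * M) - M / alpha * ((1 - \sum_(j < i.+2) p t i j) / t)
    @[t --> 0^'+] --> - (1 * M) - M / alpha * 0.
    apply: cvgB; first by apply: cvgN; apply: cvgM => //; exact: cvg_cst.
    apply: cvgM; first exact: cvg_cst.
    by apply: (trans_leave_cvg rates).
  rewrite mul1r mulr0 subr0 => lo; apply: ler_cvg_to lo Sr _.
  near=> t; have t0 : 0 < t by near: t; exact: nbhs_right_gt.
  by have /andP[] := step t t0.
- have hi : alpha * r i * expR (alpha * t) @[t --> 0^'+] --> alpha * r i * 1.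
    by apply: cvgM => //; exact: cvg_cst.
  apply: le_trans (rM i); rewrite mulr1 in hi; apply: ler_cvg_to Sr hi _.
  near=> t; have t0 : 0 < t by near: t; exact: nbhs_right_gt.
  by have /andP[] := step t t0.
Unshelve. all: by end_near. Qed.

Lemma chain_resolvent_cvg : (bd_sigma a b < +oo)%E ->
  cvgn (fun i : nat => chain_resolvent Px Y alpha f (Some i)).
Proof.
move=> sfin; apply: (bd_bounded_generator_cvg rates sfin) => i.
exact: chain_resolvent_generator_bound.
Qed.

End bounded.

Lemma chain_mean_point t x : 0 <= t -> chain_mean Px Y (\1_[set x]) t x = h t x x.
Proof.
move=> t0; rewrite /chain_mean (integral_on_states (family_chain famY x))//.
have [k0 k0x] := state_of_nat_surj x.
rewrite (@nneseriesD1 _ _ k0)//=; last first.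
  by move=> k _; rewrite mule_ge0// lee_fin.
rewrite eseries0 ?adde0; last first.
  move=> k _ /= kk0; rewrite indicE memNset ?mul0e// -k0x => /state_of_nat_inj /eqP.
  by rewrite (negbTE kk0).
by rewrite setTI k0x (family_marginal Hp famY)// indicE mem_set// mul1e.
Qed.

Lemma honest_diag_cvg x : h t x x @[t --> 0^'+] --> (1 : R).
Proof.
case: x => [i|] /=; last exact: cvg_cst.
by have := Hs (i:=i) (j:=i); rewrite eqxx.
Qed.

Lemma indic_point_bounds (x y : option nat) : 0 <= (\1_[set x] y : R) <= 1.
Proof. by rewrite indicE; case: (_ \in _); rewrite lexx ler01. Qed.

(** Only times up to [delta] are kept, when the chain sits at [x] with probability at least
    [1 - eps]. *)
Lemma chain_resolvent_point_ge (alpha eps delta : R) x : 0 < alpha -> 0 < delta ->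
  eps <= 1 -> (forall t, 0 <= t <= delta -> 1 - eps <= h t x x) ->
  (1 - eps) * (1 - expR (- (alpha * delta))) <=
  alpha * chain_resolvent Px Y alpha (\1_[set x]) x.
Proof.
move=> a0 d0 eps1 hd.
have f0 y : 0 <= (\1_[set x] y : R) by have /andP[] := indic_point_bounds x y.
have f1 y : (\1_[set x] y : R) <= 1 by have /andP[] := indic_point_bounds x y.
have mm := measurable_discounted_mean famY f0 f1 alpha x.
rewrite -ler_pdivrMl// -lee_fin -(chain_resolventE famY f0 f1 a0).
apply: (@le_trans _ _ (\int[lebesgue_measure]_(t in `[0%R, delta])
   (expR (- (alpha * t)) * chain_mean Px Y (\1_[set x]) t x)%:E)%E); last first.
  apply: ge0_subset_integral => //.
    by move=> t _; rewrite lee_fin mulr_ge0 ?expR_ge0 ?chain_mean_ge0.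
  by move=> t /=; rewrite !in_itv/= andbT => /andP[].
apply: (@le_trans _ _ (\int[lebesgue_measure]_(t in `[0%R, delta])
   ((1 - eps) / alpha * (alpha * expR (- (alpha * t))))%:E)%E); last first.
  have mE : measurable_fun (`[0, delta]%classic : set R)
     (fun t : R => ((1 - eps) / alpha * (alpha * expR (- (alpha * t))))%:E).
    apply/measurable_EFinP; do 2 apply: measurable_funM => //.
    apply: measurableT_comp => //.
    by apply: measurableT_comp => //; apply: measurable_funM.
  apply: ge0_le_integral => //.
  - move=> t _; rewrite lee_fin !mulr_ge0 ?expR_ge0// ?subr_ge0// ?invr_ge0 ltW//.
  - apply: measurable_funS mm => // t /=.
    by rewrite !in_itv/= andbT => /andP[].
  - move=> t /=; rewrite in_itv/= => /andP[t0 td].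
    rewrite lee_fin mulrA divfK ?gt_eqF// mulrC ler_wpM2l ?expR_ge0//.
    by rewrite chain_mean_point// hd// t0.
under [leRHS]eq_integral do rewrite EFinM.
rewrite ge0_integralZl_EFin//=; last 3 first.
- by move=> t _; rewrite lee_fin mulr_ge0 ?expR_ge0// ltW.
- apply/measurable_EFinP; apply: measurable_funM => //.
  apply: measurableT_comp => //.
  by apply: measurableT_comp => //; apply: measurable_funM.
- by rewrite divr_ge0 ?subr_ge0// ltW.
by rewrite integral_exp_itvcc// -EFinM lee_fin mulrA [_^-1 * _]mulrC.
Qed.

Lemma chain_resolvent_point_cvg x :
  alpha * chain_resolvent Px Y alpha (\1_[set x]) x @[alpha --> +oo] --> (1 : R).
Proof.
have f0 y : 0 <= (\1_[set x] y : R) by have /andP[] := indic_point_bounds x y.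
have f1 y : (\1_[set x] y : R) <= 1 by have /andP[] := indic_point_bounds x y.
apply/cvgrPdist_le => e e0.
(* Two errors of size [e'] have to fit into [e]; the cap at 1 is a condition of the lower bound
   [chain_resolvent_point_ge]. *)
have [e' [e'0 e'e e'1]] : exists e', [/\ 0 < e', e' <= e / 2 & e' <= 1].
  exists (Num.min (e / 2) 1).
  by rewrite lt_min divr_gt0 //= !ge_min !lexx orbT.
have /cvgrPdist_le/(_ _ e'0) := honest_diag_cvg x.
rewrite near_withinE near_simpl => /nbhs_ballP[/= D D0 HD].
pose delta := D / 2.
have delta0 : 0 < delta by rewrite divr_gt0.
have hd t : 0 <= t <= delta -> 1 - e' <= h t x x.
  move=> /andP[]; rewrite le_eqVlt => /orP[/eqP <- _|t0 td].
    case: x {f0 f1 HD} => [i|] /=; last by lra.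
    by rewrite (trans_at0 Hs Hg) eqxx gerBl ltW.
  have := HD t; rewrite /ball/= sub0r normrN gtr0_norm// => /(_ _ t0).
  have tD : t < D by apply: le_lt_trans td _; rewrite /delta; lra.
  by move=> /(_ tD); rewrite ler_norml; lra.
near=> alpha.
have a0 : 0 < alpha by near: alpha; exact: nbhs_pinfty_gt.
have ale : alpha * chain_resolvent Px Y alpha (\1_[set x]) x <= 1.
  exact: (chain_resolvent_le famY f0 f1 a0).
have age := chain_resolvent_point_ge a0 delta0 e'1 hd.
(* Past this threshold [expR (alpha * delta)] exceeds [alpha * delta], hence [e'^-1]. *)
have big : (delta * e')^-1 <= alpha by near: alpha; apply: nbhs_pinfty_ge; exact: num_real.
have small : expR (- (alpha * delta)) <= e'.
  rewrite expRN -lef_pV2 ?posrE ?invr_gt0 ?expR_gt0// invrK.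
  apply: le_trans (ltW (expR_gt1Dx _)); last by rewrite gt_eqF// mulr_gt0.
  rewrite -(ler_pM2r delta0) in big; apply: le_trans (_ : alpha * delta <= _); last by lra.
  by move: big; rewrite (_ : _^-1 * delta = e'^-1)//; field; rewrite !gt_eqF.
have := expR_gt0 (- (alpha * delta)).
have : 0 <= e' * expR (- (alpha * delta)) by rewrite mulr_ge0 ?expR_ge0 ?ltW.
rewrite ler_norml; move: age; rewrite mulrBl !mulrBr; lra.
Unshelve. all: by end_near. Qed.

End resolvent_limits.

(** * Exit from finite intervals and the flying time *)

Section discounted_exit.
Context {R : realType} (n : nat) (pr : 'I_n -> 'I_n -> R) (v : nat -> 'I_n -> R).
Variables (kappa w : 'I_n -> R) (rho eta : R).
Hypothesis vS : forall k l, v k.+1 l = \sum_j v k j * pr j l.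
Hypothesis v0 : forall k j, 0 <= v k j.
Hypothesis v1 : forall k, \sum_j v k j <= 1.
Hypothesis rho01 : 0 < rho < 1.
Hypothesis eta0 : 0 <= eta.
(** [kappa j] is the payoff for leaving from [j] in one step: either the probability of landing on
    the level [n], or that of leaving [{0, .., n-1}] at all. *)
Hypothesis near_harmonic : forall j,
  `|w j - rho * (\sum_l pr j l * w l + kappa j)| <= eta.

(* Discounted optional stopping, truncated at step K, for a function that is
   harmonic up to an error [eta] per step. *)
Lemma discounted_exit_bound (K : nat) :
  `|\sum_j v 0%N j * w j -
    (\sum_(k < K) rho ^+ k.+1 * (\sum_j v k j * kappa j) +
     rho ^+ K * \sum_j v K j * w j)| <= eta / (1 - rho).
Proof.
have [rho0 rho1] := andP rho01.
have one k : `|\sum_j v k j * w j -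
    rho * (\sum_j v k.+1 j * w j + \sum_j v k j * kappa j)| <= eta.
  have -> : \sum_j v k.+1 j * w j = \sum_j v k j * \sum_l pr j l * w l.
    under eq_bigr do rewrite vS mulr_suml.
    rewrite exchange_big/=; apply: eq_bigr => j _.
    by rewrite mulr_sumr; apply: eq_bigr => l _; rewrite mulrA.
  rewrite -big_split/= mulr_sumr -sumrB.
  apply: (@le_trans _ _ (\sum_j v k j * eta)).
    apply: le_trans (ler_norm_sum _ _ _) _; apply: ler_sum => j _.
    rewrite (_ : _ - _ = v k j * (w j - rho * (\sum_l pr j l * w l + kappa j))); last by ring.
    by rewrite normrM ger0_norm// ler_wpM2l.
  rewrite -mulr_suml ler_piMl//.
(* The errors are discounted, so their sum is bounded independently of [K]. *)
have geo : \sum_(k < K) rho ^+ k * eta <= eta / (1 - rho).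
  have := @geometric_le_lim R K eta rho eta0 rho0.
  rewrite gtr0_norm// => /(_ rho1); apply: le_trans.
  rewrite /series/= big_mkord; apply: ler_sum => k _.
  by rewrite mulrC.
apply: le_trans geo; elim: K => [|K IH].
  by rewrite !big_ord0 add0r expr0 mul1r subrr normr0.
rewrite !big_ord_recr/=.
set x := \sum_j v 0%N j * w j in IH *; set S := \sum_(k < K) rho ^+ k.+1 * _ in IH *.
set y := \sum_j v K j * w j in IH one *.
set z := \sum_j v K.+1 j * w j; set u := \sum_j v K j * kappa j.
have := one K; rewrite -/y -/z -/u => oneK.
rewrite (_ : x - _ = (x - (S + rho ^+ K * y)) + rho ^+ K * (y - rho * (z + u))); last first.
  by rewrite exprS; ring.
apply: le_trans (ler_normD _ _) _; apply: lerD => //.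
by rewrite normrM normrX gtr0_norm// ler_wpM2l// exprn_ge0// ltW.
Qed.

End discounted_exit.

(** * Laws on a time grid up to the first exit *)

Section grid_law.
Context {R : realType} (p : R -> nat -> nat -> R).
Context {d} {T : measurableType d}.
Context (Px : option nat -> probability T R) (Y : R -> T -> ext_state R).
Hypothesis Hp : transition_matrix p.
Hypothesis famY : canonical_family Px Y p.
Variables (h : R) (n i : nat).
Hypothesis h0 : 0 <= h.

Definition below (n : nat) : set (ext_state R) :=
  [set x | exists2 j : nat, (j < n)%N & x = emb_state (Some j)].

(* [forward r y] is the probability, starting from [i], of having stayed in
   [{0, .., n-1}] at the times [0, h, .., (r-1)h] and of being in [y] at time [r h]. *)
Fixpoint forward (r : nat) (y : option nat) : R :=
  if r is r'.+1 then \sum_(j < n) forward r' (Some (j : nat)) * honest_ext p h (Some (j : nat)) y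
  else (y == Some i)%:R.

(** The inequality is strict: the position at time [r * h] stays free, in step with [forward]. *)
Definition stay (r : nat) : set T := [set w | forall l, (l < r)%N -> below n (Y (l%:R * h) w)].

Lemma below_measurable m : ext_measurable (below m).
Proof.
rewrite (_ : below m = \bigcup_(j in [set j | (j < m)%N]) [set @emb_state R (Some j)]).
  by rewrite /ext_measurable preimage_bigcup; apply: bigcup_measurable => j _; exact: ext_measurable_state.
by apply/seteqP; split => x [j jm xj]; exists j.
Qed.

Lemma stay_measurable r : measurable (stay r).
Proof.
rewrite (_ : stay r = \bigcap_(l in [set l | (l < r)%N]) (Y (l%:R * h) @^-1` below n)).
  apply: bigcap_measurableType => l _.
  by apply: (chain_measurable_preimage (family_chain famY None)) => //;
    [rewrite mulr_ge0|exact: below_measurable].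
by apply/seteqP; split => w H l; exact: H.
Qed.

(** Free in [{0, .., n-1}] before step [r], prescribed from [r] to [N]. The finite-dimensional laws
    settle [r = 0], and the prescribed tail is what lets the induction on [r] proceed. *)
Let hitting r (N : nat) (x : nat -> option nat) : set T :=
  [set w | stay r w /\ forall l, (r <= l <= N)%N -> Y (l%:R * h) w = emb_state (x l)].

Let hitting_measurable r N x : measurable (hitting r N x).
Proof.
apply: measurableI; first exact: stay_measurable.
rewrite (_ : (fun w => _) = \bigcap_(l in [set l | (r <= l <= N)%N]) [set w | Y (l%:R * h) w = emb_state (x l)]).
  apply: bigcap_measurableType => l _.
  by apply: (chain_measurable_at (family_chain famY None)); rewrite mulr_ge0.
by apply/seteqP; split => w H l; exact: H.
Qed.

Lemma forward_ge0 r y : 0 <= forward r y.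
Proof.
elim: r y => [|r IH] y /=; first exact: ler0n.
by apply: sumr_ge0 => j _; apply: mulr_ge0; [exact: IH|exact: (honest_ge0 Hp (Some (j : nat)) y h0)].
Qed.

Let hitting_law r N x : (r <= N)%N ->
  Px (Some i) (hitting r N x) =
  (forward r (x r) * \prod_(r <= l < N) honest_ext p h (x l) (x l.+1))%:E.
Proof.
elim: r x => [|r IH] x rN.
  have := @chain_fidi _ _ _ _ _ _ _ (family_chain famY (Some i)) N (fun l => l%:R * h) x.
  rewrite mul0r => /(_ erefl).
  have -> : [set w | forall k, (k <= N)%N -> Y (k%:R * h) w = emb_state (x k)] = hitting 0 N x.
    apply/seteqP; split => w /=; first by move=> H; split => // l /= lN; exact: H.
    by move=> [_ H] l lN; exact: H.
  move=> ->; last by move=> k; rewrite ler_wpM2r// ler_nat.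
  rewrite /= EFinM /init_dirac big_mkord; congr (_ * _%:E)%E.
  by apply: eq_bigr => k _; rewrite -mulrBl -natrB// subSnn mul1r.
(* Freeing step [r] amounts to a disjoint union over the state [j] occupied then, which [x']
   records. *)
pose x' (j : nat) l := if l == r then Some j else x l.
have -> : hitting r.+1 N x = \big[setU/set0]_(j < n) hitting r N (x' j).
  rewrite -(bigcup_mkord n (fun j => hitting r N (x' j))).
  apply/seteqP; split => w /=.
    move=> [Hs H]; have [j jn Yj] := Hs r (ltnSn r).
    exists j => //; split; first by move=> l lr; apply: Hs; exact: leqW.
    move=> l /andP[rl lN]; rewrite /x'; case: eqP => [->//|/eqP lr].
    by apply: H; rewrite lN andbT ltn_neqAle eq_sym lr.
  move=> [j /= jn [Hs H]]; split.
    move=> l; rewrite ltnS leq_eqVlt => /orP[/eqP ->|]; last exact: Hs.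
    exists j => //; have := H r; rewrite leqnn ltnW// => /(_ isT).
    by rewrite /x' eqxx.
  move=> l /andP[rl lN]; have := H l; rewrite lN (ltnW rl) => /(_ isT).
  by rewrite /x' gtn_eqF.
rewrite measure_semi_additive_ord//; last 2 first.
- apply/trivIsetP => j1 j2 _ _ j12; apply/seteqP; split => [w|w]//= [[_ H1] [_ H2]].
  have := H1 r; have := H2 r; rewrite leqnn ltnW// => /(_ isT) + /(_ isT).
  rewrite /x' eqxx => -> E.
  have /= [/val_inj j21] := @emb_state_inj R (Some (j2 : nat)) (Some (j1 : nat)) E.
  by move: j12; rewrite j21 eqxx.
- exact: bigsetU_measurable.
rewrite mulr_suml -sumEFin; apply: eq_bigr => j _.
etransitivity; first exact: (IH (x' j) (ltnW rN)).
rewrite /x' eqxx big_ltn// eqxx (gtn_eqF (ltnSn r)) mulrA.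
congr (_ * _)%:E; apply: eq_big_nat => l /andP[rl _].
by rewrite !gtn_eqF// ltnW.
Qed.

Lemma stay_at_law r y :
  Px (Some i) (stay r `&` [set w | Y (r%:R * h) w = emb_state y]) = (forward r y)%:E.
Proof.
have := @hitting_law r r (fun=> y) (leqnn r).
rewrite big_geq// mulr1 => <-; congr (Px _ _); apply/seteqP; split => w /=.
  by move=> [H1 H2]; split => // l; rewrite -eqn_leq => /eqP <-.
by move=> [H1 H2]; split => //; apply: H2; rewrite leqnn.
Qed.

Lemma stay_law r : Px (Some i) (stay r.+1) = (\sum_(j < n) forward r (Some (j : nat)))%:E.
Proof.
have -> : stay r.+1 = \big[setU/set0]_(j < n)
    (stay r `&` [set w | Y (r%:R * h) w = emb_state (Some (j : nat))]).
  rewrite -(bigcup_mkord n (fun j => stay r `&` [set w | Y (r%:R * h) w = emb_state (Some j)])).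
  apply/seteqP; split => w /=.
    move=> Hs; have [j jn Yj] := Hs r (ltnSn r).
    by exists j => //; split => // l lr; apply: Hs; exact: leqW.
  move=> [j /= jn [Hs Yj]] l; rewrite ltnS leq_eqVlt => /orP[/eqP ->|]; last exact: Hs.
  by exists j.
have mE (j : 'I_n) : measurable (stay r `&` [set w | Y (r%:R * h) w = emb_state (Some (j : nat))]).
  apply: measurableI; first exact: stay_measurable.
  by apply: (chain_measurable_at (family_chain famY None)); rewrite mulr_ge0.
rewrite measure_semi_additive_ord//; last 2 first.
- apply/trivIsetP => j1 j2 _ _ j12; apply/seteqP; split => [w|w]//= [[_ ->] [_ E]].
  have /= [/val_inj j21] := @emb_state_inj R (Some (j1 : nat)) (Some (j2 : nat)) E.
  by move: j12; rewrite j21 eqxx.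
- exact: bigsetU_measurable.
by rewrite -sumEFin; apply: eq_bigr => j _; exact: stay_at_law.
Qed.

End grid_law.

Lemma one_sub_exp_bounds {R : realType} (h : R) : 0 < h ->
  (1 + h)^-1 <= (1 - expR (- h)) / h <= 1.
Proof.
move=> h0; have h1 : 0 < 1 + h by lra.
have e1 : expR (- h) <= (1 + h)^-1.
  by rewrite expRN lef_pV2 ?posrE ?expR_gt0// expR_ge1Dx.
rewrite ler_pdivrMr// ler_pdivlMr// mul1r; apply/andP; split.
  have : (1 + h)^-1 * h = 1 - (1 + h)^-1 by field; rewrite gt_eqF.
  lra.
by have := expR_ge1Dx (- h); lra.
Qed.

Lemma one_sub_exp_cvg {R : realType} : (1 - expR (- h)) / h @[h --> 0^'+] --> (1 : R).
Proof.
have lo : (1 + h)^-1 @[h --> (0 : R)^'+] --> (1 : R).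
  have : (1 + h)^-1 @[h --> (0 : R)^'+] --> (1 + 0 : R)^-1.
    apply: cvgV; first by rewrite addr0.
    by apply: cvgD; [exact: cvg_cst | exact: cvg_at_right_filter].
  by rewrite addr0 invr1.
apply: squeeze_cvgr lo (cvg_cst _).
near=> h; apply: one_sub_exp_bounds; near: h; exact: nbhs_right_gt.
Unshelve. all: by end_near. Qed.

(** * Discounted exit probabilities on fine grids *)

Section exit_bounds.
Context {R : realType} (a b : nat -> R) (p : R -> nat -> nat -> R).
Hypothesis rates : birth_death_rates a b.
Hypothesis Hp : transition_matrix p.
Hypothesis Hs : standard p.
Hypothesis Hg : has_generator p (bd_matrix a b).
Local Notation g := (bd_eigen a b).

(** Normalised to be 1 at the exit level [n]. *)
Let w n j := g j / g n.

(** As [w n] is an eigenfunction of eigenvalue 1, one transition discounted by [expR (- h)]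
    reproduces it up to o(h). The two payoffs differ by the chance of being outside the first [n.+1]
    states, again o(h). *)
Let near_harmonic n (j : 'I_n) (delta : R) : 0 < delta ->
  \forall h \near 0^'+,
  `|w n j - expR (- h) * (\sum_(l < n) p h j l * w n l + p h j n)| <= delta * h /\
  `|w n j - expR (- h) * (\sum_(l < n) p h j l * w n l +
      (1 - \sum_(l < n) p h j l))| <= delta * h.
Proof.
move=> d0.
have gn : g n != 0 by rewrite gt_eqF// bd_eigen_gt0.
have exp1 : expR (- t) @[t --> (0 : R)^'+] --> (1 : R).
  rewrite -expR0 -[X in expR X]oppr0.
  by apply: cvg_at_right_filter; apply: continuous_comp; [exact: opp_continuous|exact: continuous_expR].
have jn : (j.+1 < n.+1)%N by rewrite ltnS.
have Qw : \sum_(l < n.+1) bd_matrix a b j l * w n l = w n j.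
  rewrite -[RHS](congr1 (fun x => x / g n) (bd_eigen_generator rates jn)) mulr_suml.
  by apply: eq_bigr => l _; rewrite mulrA.
have c1 := @trans_generator_apply _ _ _ _ Hs Hg n.+1 j (w n) jn; rewrite Qw in c1.
have c2 : w n j * ((1 - expR (- t)) / t) - expR (- t) * ((\sum_(l < n.+1) p t j l * w n l - w n j) / t)
    @[t --> 0^'+] --> w n j * 1 - 1 * w n j.
  apply: cvgB; last by apply: cvgM; [exact: exp1|exact: c1].
  by apply: cvgM; [exact: cvg_cst | exact: one_sub_exp_cvg].
rewrite mulr1 mul1r subrr in c2.
have c3 : expR (- t) * ((1 - \sum_(l < n.+1) p t j l) / t) @[t --> 0^'+] --> (1 : R) * 0.
  by apply: cvgM; [exact: exp1 | exact: (trans_leave_cvg rates Hs Hg)].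
rewrite mulr0 in c3.
have c4 : w n j * ((1 - expR (- t)) / t) - expR (- t) * ((\sum_(l < n.+1) p t j l * w n l - w n j) / t) -
    expR (- t) * ((1 - \sum_(l < n.+1) p t j l) / t) @[t --> 0^'+] --> (0 : R) - 0.
  by apply: cvgB; [exact: c2|exact: c3].
rewrite subr0 in c4.
move/cvgr0Pnorm_le : c2 => /(_ _ d0) c2.
move/cvgr0Pnorm_le : c4 => /(_ _ d0) c4.
near=> h; have h0 : 0 < h by near: h; exact: nbhs_right_gt.
have normE (x : R) : `|x| / h = `|x / h| by rewrite normrM normfV (gtr0_norm h0).
have wnn : w n n = 1 by rewrite /w divff.
split.
- rewrite -ler_pdivrMr// normE.
  have : `|w n j * ((1 - expR (- h)) / h) -
      expR (- h) * ((\sum_(l < n.+1) p h j l * w n l - w n j) / h)| <= delta.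
    by near: h.
  rewrite big_ord_recr/= wnn mulr1 => H.
  rewrite (_ : _ / h = w n j * ((1 - expR (- h)) / h) -
     expR (- h) * ((\sum_(i < n) p h j i * w n i + p h j n - w n j) / h)); last by ring.
  by apply: H.
- rewrite -ler_pdivrMr// normE.
  have : `|w n j * ((1 - expR (- h)) / h) - expR (- h) * ((\sum_(l < n.+1) p h j l * w n l - w n j) / h) -
    expR (- h) * ((1 - \sum_(l < n.+1) p h j l) / h)| <= delta.
    by near: h.
  rewrite !big_ord_recr/= wnn mulr1 => H.
  rewrite (_ : _ / h = w n j * ((1 - expR (- h)) / h) -
     expR (- h) * ((\sum_(i < n) p h j i * w n i + p h j n - w n j) / h) -
     expR (- h) * ((1 - (\sum_(i < n) p h j i + p h j n)) / h)); last by ring.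
  by apply: H.
Unshelve. all: by end_near. Qed.

(** Optional stopping yields the same value [g i / g n] from below for exits that land on [n], and
    from above for exits that land anywhere. The mesh is chosen before [K], so [K] may grow on a
    fixed grid. *)
Lemma exit_bounds n i (delta : R) : (i < n)%N -> 0 < delta ->
  \forall h \near 0^'+, forall K,
  g i / g n - delta - expR (- h) ^+ K <=
    \sum_(k < K) expR (- h) ^+ k.+1 * forward p h n i k.+1 (Some n) /\
  \sum_(k < K) expR (- h) ^+ k.+1 *
     (\sum_(j < n) forward p h n i k (Some (j : nat)) -
      \sum_(j < n) forward p h n i k.+1 (Some (j : nat))) <= g i / g n + delta.
Proof.
move=> i_n d0; have d20 : 0 < delta / 2 by rewrite divr_gt0.
pose nearly_harmonic (h : R) := forall j : 'I_n,
  `|w n j - expR (- h) * (\sum_(l < n) p h j l * w n l + p h j n)| <= delta / 2 * h /\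
  `|w n j - expR (- h) * (\sum_(l < n) p h j l * w n l +
      (1 - \sum_(l < n) p h j l))| <= delta / 2 * h.
have nearH : \forall h \near 0^'+, nearly_harmonic h.
  by apply: filter_forall => j; exact: near_harmonic.
near=> h; have h0 : 0 < h by near: h; exact: nbhs_right_gt.
have h1 : h <= 1 by near: h; exact: nbhs_right_le.
have H : nearly_harmonic h by near: h.
move=> K.
pose v k (j : 'I_n) := forward p h n i k (Some (j : nat)).
pose pr (j l : 'I_n) := p h j l.
have vS k l : v k.+1 l = \sum_j v k j * pr j l by [].
have v0 k j : 0 <= v k j by apply: forward_ge0 => //; exact: ltW.
have pr1 (j : 'I_n) : \sum_(l < n) p h j l <= 1 by apply: trans_sum_le1 => //; exact: ltW.
have v1 k : \sum_j v k j <= 1.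
  elim: k => [|k IH].
    rewrite /v /= (bigD1 (Ordinal i_n))//= eqxx big1 ?addr0// => j ji.
    by case: eqP => // -[ij]; move: ji; rewrite -val_eqE/= ij eqxx.
  under eq_bigr do rewrite vS.
  rewrite exchange_big/=; apply: le_trans IH; apply: ler_sum => j _.
  by rewrite -mulr_sumr; apply: ler_piMr; [exact: v0|exact: pr1].
have rho01 : 0 < expR (- h) < 1.
  by rewrite expR_gt0/= -expR0 ltr_expR oppr_lt0.
have eta0 : 0 <= delta / 2 * h by rewrite mulr_ge0 ?ltW.
(* For [h <= 1] one has [1 - expR (- h) >= h / 2], which is why the error per step was set to
   [delta / 2 * h]. *)
have eta_le : delta / 2 * h / (1 - expR (- h)) <= delta.
  have /andP[lo _] := one_sub_exp_bounds h0.
  have [_ r1] := andP rho01.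
  rewrite ler_pdivrMr ?subr_gt0//.
  have : 2^-1 <= (1 + h)^-1 by rewrite lef_pV2 ?posrE; lra.
  move=> /le_trans/(_ lo); rewrite ler_pdivlMr// => l2.
  by rewrite -mulrA ler_wpM2l// ltW.
have w0 j : 0 <= w n j by rewrite divr_ge0// ltW// bd_eigen_gt0.
have w1 (j : 'I_n) : w n j <= 1.
  rewrite ler_pdivrMr ?bd_eigen_gt0// mul1r bd_eigen_increasing// ltnW//.
have vw0 k : 0 <= \sum_j v k j * w n j by apply: sumr_ge0 => j _; rewrite mulr_ge0.
have vw1 k : \sum_j v k j * w n j <= 1.
  by apply: le_trans (v1 k); apply: ler_sum => j _; rewrite ler_piMr.
have init : \sum_j v 0%N j * w n j = g i / g n.
  rewrite /v /= (bigD1 (Ordinal i_n))//= eqxx mul1r big1 ?addr0// => j ji.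
  by case: eqP => [[ij]|_]; rewrite ?mul0r//; move: ji; rewrite -val_eqE/= ij eqxx.
have rhoK : 0 <= expR (- h) ^+ K by rewrite exprn_ge0// expR_ge0.
split.
- have := discounted_exit_bound vS v0 v1 rho01 eta0 (fun j => proj1 (H j)) K.
  rewrite init => /le_trans/(_ eta_le).
  have : expR (- h) ^+ K * \sum_j v K j * w n j <= expR (- h) ^+ K by rewrite ler_piMr.
  have -> : \sum_(k < K) expR (- h) ^+ k.+1 * forward p h n i k.+1 (Some n) =
    \sum_(k < K) expR (- h) ^+ k.+1 * (\sum_j v k j * p h j n) by [].
  by rewrite ler_norml; lra.
- have := discounted_exit_bound vS v0 v1 rho01 eta0 (fun j => proj2 (H j)) K.
  rewrite init => /le_trans/(_ eta_le).
  have : 0 <= expR (- h) ^+ K * \sum_j v K j * w n j by rewrite mulr_ge0.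
  have -> : \sum_(k < K) expR (- h) ^+ k.+1 * (\sum_(j < n) v k j - \sum_(j < n) v k.+1 j) =
    \sum_(k < K) expR (- h) ^+ k.+1 * (\sum_j v k j * (1 - \sum_(l < n) p h j l)).
    apply: eq_bigr => k _; congr (_ * _).
    under [X in _ - X]eq_bigr do rewrite vS.
    rewrite exchange_big/= -sumrB; apply: eq_bigr => j _.
    by rewrite mulrBr mulr1 mulr_sumr.
  by rewrite ler_norml; lra.
Unshelve. all: by end_near. Qed.

End exit_bounds.

Section nonmeasurable_integral.
Import HBNNSimple.

(* The flying time is an infimum over an uncountable set of times and need not
   be measurable, hence no measurability assumption on [f]. *)
Lemma ge0_ae_eq_integral_nonmeasurable {d} {T : measurableType d} {R : realType}
    (mu : {measure set T -> \bar R}) (f g : T -> \bar R) :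
  (forall x, (0 <= f x)%E) -> (forall x, (0 <= g x)%E) -> measurable_fun setT g ->
  {ae mu, forall x, f x = g x} -> (\int[mu]_x f x = \int[mu]_x g x)%E.
Proof.
move=> f0 g0 mg [N [mN N0 HN]].
have fg x : ~ N x -> f x = g x.
  by move=> Nx; apply: contrapT => fgx; apply: Nx; apply: HN.
apply/eqP; rewrite eq_le; apply/andP; split.
  (* The integral of [f] is a supremum over simple functions below [f]; these are measurable, and
     below [g] off the null set. *)
  rewrite ge0_integralTE//; apply: ge_ereal_sup => _ [h hf <-].
  rewrite -integralT_nnsfun.
  rewrite (@ge0_negligible_integral _ _ _ _ _ N)//; last 2 first.
  - by apply: measurable_funTS; exact/measurable_EFinP.
  - by move=> x _; rewrite lee_fin.
  rewrite [leRHS](@ge0_negligible_integral _ _ _ _ _ N)//.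
  apply: ge0_le_integral => //.
  - exact: measurableD.
  - by move=> x _; rewrite lee_fin.
  - by apply: measurable_funTS; exact/measurable_EFinP.
  - exact: measurable_funTS.
  - by move=> x [_ Nx]; rewrite -fg//; exact: hf.
rewrite (@ge0_negligible_integral _ _ _ _ _ N)// integral_mkcond.
have r0 x : (0 <= (g \_ (setT `\` N)) x)%E by rewrite patchE; case: ifP.
rewrite ge0_integralTE// [leRHS]ge0_integralTE//; apply: ereal_sup_le.
move=> _ [h hg <-]; exists h => // x; apply: le_trans (hg x) _.
rewrite patchE; case: ifPn => // /set_mem [_ Nx]; by rewrite fg.
Qed.

End nonmeasurable_integral.

Lemma half_expn_cvg {R : realType} : (2^-1 : R) ^+ n @[n --> \oo] --> (0 : R).
Proof. by apply: cvg_expr; rewrite ger0_norm// invf_lt1// ltr1n. Qed.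

Lemma near_right_dyadic {R : realType} (Q : R -> Prop) :
  (\forall h \near (0 : R)^'+, Q h) -> \forall m \near \oo, Q (2^-1 ^+ m).
Proof.
rewrite /at_right near_withinE => nQ.
have : \forall m \near \oo, (fun u => 0 < u -> Q u) (2^-1 ^+ m) := half_expn_cvg nQ.
apply: filterS => m /= H.
by apply: H; apply: exprn_gt0; rewrite invr_gt0.
Qed.

(** * Discounts at dyadic times *)

Section dyadic_sup.
Context {R : realType} {d} {T : measurableType d} (Y : R -> T -> ext_state R).
Hypothesis mY : forall t, 0 <= t -> ext_measurable_fun setT (Y t).

(** The shift to [k.+1] keeps the times positive, as in [hitting_time]. *)
Definition dyadic (m k : nat) : R := k.+1%:R * 2^-1 ^+ m.

Lemma dyadic_gt0 m k : 0 < dyadic m k.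
Proof. by rewrite mulr_gt0// exprn_gt0. Qed.

Lemma dyadicS m k : dyadic m.+1 k.*2.+1 = dyadic m k.
Proof.
rewrite /dyadic -doubleS -muln2 natrM exprS -mulrA; congr (_ * _).
by rewrite mulrA divff ?mul1r.
Qed.

Definition discounted_visit (B : set (ext_state R)) m k w : \bar R :=
  (expR (- dyadic m k) * \1_B (Y (dyadic m k) w))%:E.

Definition grid_sup B m w := ereal_sup (range (discounted_visit B m ^~ w)).

(* [exp(-tau)] for the infimum [tau] of the positive dyadic times spent in [B]. *)
Definition dyadic_sup B w := ereal_sup (range (grid_sup B ^~ w)).

Lemma discounted_visit_ge0 B m k w : (0 <= discounted_visit B m k w)%E.
Proof. by rewrite lee_fin mulr_ge0 ?expR_ge0// indicE. Qed.

Lemma discounted_visit_le1 B m k w : (discounted_visit B m k w <= 1)%E.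
Proof.
rewrite lee_fin -[leRHS]mulr1 ler_pM ?expR_ge0 ?indicE//.
  by rewrite -expR0 ler_expR oppr_le0 ltW ?dyadic_gt0.
by case: (_ \in _).
Qed.

Lemma grid_sup_ge0 B m w : (0 <= grid_sup B m w)%E.
Proof.
by apply: le_trans (discounted_visit_ge0 B m 0 w) _; apply: ereal_sup_ubound; exists 0%N.
Qed.

Lemma grid_sup_nondecreasing B w : {homo grid_sup B ^~ w : m n / (m <= n)%N >-> (m <= n)%E}.
Proof.
apply/nondecreasing_seqP => m; apply: ge_ereal_sup => _ [k _ <-].
apply: ereal_sup_ubound; exists k.*2.+1 => //.
by rewrite /discounted_visit dyadicS.
Qed.

Lemma dyadic_sup_ge0 B w : (0 <= dyadic_sup B w)%E.
Proof.
by apply: le_trans (grid_sup_ge0 B 0 w) _; apply: ereal_sup_ubound; exists 0%N.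
Qed.

Lemma dyadic_sup_le B w (y : \bar R) : 
  (forall m k, (discounted_visit B m k w <= y)%E) -> (dyadic_sup B w <= y)%E.
Proof.
move=> H; apply: ge_ereal_sup => _ [m _ <-]; apply: ge_ereal_sup => _ [k _ <-]; exact: H.
Qed.

Lemma le_dyadic_sup B m k w : (discounted_visit B m k w <= dyadic_sup B w)%E.
Proof.
apply: (@le_trans _ _ (grid_sup B m w)); apply: ereal_sup_ubound; first by exists k.
by exists m.
Qed.

Lemma dyadic_sup_le1 B w : (dyadic_sup B w <= 1)%E.
Proof. by apply: dyadic_sup_le => m k; exact: discounted_visit_le1. Qed.

Lemma le_dyadic_sup_set B C w : B `<=` C -> (dyadic_sup B w <= dyadic_sup C w)%E.
Proof.
move=> BC; apply: dyadic_sup_le => m k; apply: le_trans (le_dyadic_sup C m k w).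
rewrite lee_fin ler_wpM2l ?expR_ge0// !indicE; case: (boolP (_ \in B)) => [/set_mem/BC/mem_set ->//|_].
by case: (_ \in C).
Qed.

Lemma measurable_discounted_visit B m k : ext_measurable B ->
  measurable_fun setT (discounted_visit B m k).
Proof.
move=> mB; apply/measurable_EFinP; apply: measurable_funM => //.
rewrite (_ : (fun w => _) = \1_(Y (dyadic m k) @^-1` B)); last by [].
apply: measurable_indic; rewrite -[X in measurable X]setTI.
by apply: mY => //; rewrite ltW// dyadic_gt0.
Qed.

Lemma measurable_range_sup (f : (T -> \bar R)^nat) :
  (forall k, measurable_fun setT (f k)) ->
  measurable_fun setT (fun w => ereal_sup (range (f ^~ w))).
Proof.
move=> mf; have := measurable_fun_esups mf 0%N; congr (measurable_fun _ _).
apply/funext => w; rewrite /esups/= /sdrop; congr ereal_sup.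
by apply/seteqP; split => [_ [k _ <-]|_ [k _ <-]]; exists k.
Qed.

Lemma measurable_grid_sup B m : ext_measurable B -> measurable_fun setT (grid_sup B m).
Proof.
by move=> mB; apply: measurable_range_sup => k; exact: measurable_discounted_visit.
Qed.

Lemma measurable_dyadic_sup B : ext_measurable B -> measurable_fun setT (dyadic_sup B).
Proof. by move=> mB; apply: measurable_range_sup => k; exact: measurable_grid_sup. Qed.

(** Monotone convergence along the nested grids, so a bound on the fine ones suffices. *)
Lemma integral_dyadic_sup_le (mu : {measure set T -> \bar R}) B (c : \bar R) :
  ext_measurable B ->
  (\forall m \near \oo, (\int[mu]_w grid_sup B m w <= c)%E) ->
  (\int[mu]_w dyadic_sup B w <= c)%E.
Proof.
move=> mB nc.
have -> : (\int[mu]_w dyadic_sup B w = \int[mu]_w limn (grid_sup B ^~ w))%E.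
  apply: eq_integral => w _; apply/esym/cvg_lim => //.
  exact/ereal_nondecreasing_cvgn/grid_sup_nondecreasing.
rewrite monotone_convergence//; last 3 first.
- by move=> m; exact: measurable_grid_sup.
- by move=> m w _; exact: grid_sup_ge0.
- by move=> w _; exact: grid_sup_nondecreasing.
apply: lime_le => //; apply: ereal_nondecreasing_is_cvgn => m n mn.
apply: ge0_le_integral => //.
- by move=> w _; exact: grid_sup_ge0.
- exact: measurable_grid_sup.
- exact: measurable_grid_sup.
- by move=> w _; exact: grid_sup_nondecreasing.
Qed.

End dyadic_sup.

Lemma dyadic_next {R : realType} n (t : R) : 0 <= t ->
  t < dyadic n (Num.truncn (t / 2^-1 ^+ n)) <= t + 2^-1 ^+ n.
Proof.
move=> t0; have h0 : 0 < (2^-1 : R) ^+ n by rewrite exprn_gt0.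
have y0 : 0 <= t / 2^-1 ^+ n by rewrite divr_ge0// ltW.
have := truncn_itv y0; set k := Num.truncn _ => /andP[].
have kE : k.+1%:R = k%:R + 1 :> R by rewrite natr1.
rewrite ler_pdivlMr// ltr_pdivrMr// /dyadic kE mulrDl mul1r => lo hi.
by rewrite hi lerD2r.
Qed.

Lemma integral_scaled_indic {d} {T : measurableType d} {R : realType}
    (mu : {measure set T -> \bar R}) (c : R) (A : set T) : 0 <= c ->
  measurable A -> (\int[mu]_w (c * \1_A w)%:E)%E = (c%:E * mu A)%E.
Proof.
move=> c0 mA; rewrite -[in RHS](setIT A) -integral_indic//.
rewrite -ge0_integralZl_EFin//.
by apply/measurable_EFinP; exact: measurable_indic.
Qed.

(** * Expected discounts at exits and visits *)

Section first_visit.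
Context {R : realType} (a b : nat -> R) (p : R -> nat -> nat -> R).
Context {d} {T : measurableType d}.
Context (Px : option nat -> probability T R) (Y : R -> T -> ext_state R).
Hypothesis rates : birth_death_rates a b.
Hypothesis Hp : transition_matrix p.
Hypothesis Hs : standard p.
Hypothesis Hg : has_generator p (bd_matrix a b).
Hypothesis famY : canonical_family Px Y p.
Local Notation g := (bd_eigen a b).
Local Notation dyadic := (@dyadic R).

Lemma family_measurable t : 0 <= t -> ext_measurable_fun setT (Y t).
Proof. exact: (chain_measurable (family_chain famY None)). Qed.

Section level.
Variables (i n : nat).
Hypothesis i_n : (i < n)%N.
Let P := Px (Some i).
Local Notation hm m := ((2^-1 : R) ^+ m).
Local Notation rho m := (expR (- hm m)).
Local Notation stay m := (stay Y (hm m) n).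

Let hm0 m : 0 <= hm m. Proof. by rewrite exprn_ge0. Qed.

Let expR_dyadic m k : expR (- dyadic m k) = rho m ^+ k.+1.
Proof. by rewrite -expRM_natl /dyadic mulrN. Qed.

Let stay_anti m r r' : (r <= r')%N -> stay m r' `<=` stay m r.
Proof. by move=> rr' w H l lr; apply: H; exact: leq_trans rr'. Qed.

Let first_exit m k : set T := stay m k `\` stay m k.+1.

Let mstay m r : measurable (stay m r).
Proof. exact: (stay_measurable famY). Qed.

(** The earliest exit on the grid has the largest discount. The series also counts an exit at step
    0, a time absent from [dyadic]; this event is null because the chain starts below [n]. *)
Let grid_sup_le_series m w :
  (grid_sup Y (~` below n) m w <=
   \sum_(k <oo) (rho m ^+ k * \1_(first_exit m k) w)%:E)%E.
Proof.
have rho0 k : 0 <= rho m ^+ k by rewrite exprn_ge0// expR_ge0.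
have term0 k : (0 <= (rho m ^+ k * \1_(first_exit m k) w)%:E)%E.
  by rewrite lee_fin mulr_ge0// indicE.
apply: ge_ereal_sup => _ [k _ <-]; rewrite /discounted_visit.
have [out|inn] := pselect (below n (Y (dyadic m k) w)).
  rewrite indicE memNset ?mulr0; last by apply.
  by apply: nneseries_ge0 => j _ _.
have ex : exists l, `[< ~ below n (Y (l%:R * hm m) w) >].
  by exists k.+1; apply/asboolP.
have := ex_minnP ex => -[l /asboolP lout lmin].
have lk : (l <= k.+1)%N by apply: lmin; apply/asboolP.
have fl : first_exit m l w.
  split; last by move=> H; apply: lout; apply: H.
  move=> j jl; apply: contrapT => jout.
  by have := lmin j (asboolT jout); rewrite leqNgt jl.
apply: (@le_trans _ _ (rho m ^+ l * \1_(first_exit m l) w)%:E).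
  rewrite lee_fin expR_dyadic !indicE (mem_set fl) mem_set// !mulr1.
  have r1 : rho m <= 1 by rewrite -expR0 ler_expR oppr_le0.
  by rewrite ler_wiXn2l ?expR_ge0.
have := @nneseries_lim_ge R (fun k => (rho m ^+ k * \1_(first_exit m k) w)%:E) xpredT 0 l.+1.
move=> /(_ (fun k _ _ => term0 k)); apply: le_trans.
by rewrite big_nat_recr//= leeDr// sume_ge0.
Qed.

Lemma integral_grid_sup_le m (c : R) :
  (forall K, \sum_(k < K) rho m ^+ k.+1 *
     (\sum_(j < n) forward p (hm m) n i k (Some (j : nat)) -
      \sum_(j < n) forward p (hm m) n i k.+1 (Some (j : nat))) <= c) ->
  (\int[P]_w grid_sup Y (~` below n) m w <= c%:E)%E.
Proof.
move=> Hc.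
have mfe k : measurable (first_exit m k) by apply: measurableD.
have mterm k : measurable_fun setT (fun w => (rho m ^+ k * \1_(first_exit m k) w)%:E).
  by apply/measurable_EFinP; apply: measurable_funM => //; exact: measurable_indic.
have rho0 k : 0 <= rho m ^+ k by rewrite exprn_ge0// expR_ge0.
have term0 k w : (0 <= (rho m ^+ k * \1_(first_exit m k) w)%:E)%E.
  by rewrite lee_fin mulr_ge0// indicE.
pose s k := \sum_(j < n) forward p (hm m) n i k (Some (j : nat)).
have Pstay k : P (stay m k.+1) = (s k)%:E by exact: (stay_law famY n i (hm0 m) k).
have Pstay0 : P (stay m 0) = 1%E.
  by rewrite (_ : stay m 0 = setT) ?probability_setT//; apply/seteqP; split.
have s0 : s 0%N = 1.
  rewrite /s /= (bigD1 (Ordinal i_n))//= eqxx big1 ?addr0// => j ji.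
  by case: eqP => // -[ij]; move: ji; rewrite -val_eqE/= ij eqxx.
have Pfe k : P (first_exit m k.+1) = (s k - s k.+1)%:E.
  rewrite /first_exit measureD//; last by rewrite ltey_eq fin_num_measure.
  rewrite (setIidr (@stay_anti m _ _ (leqnSn k.+1))) EFinB.
  by congr (_ - _)%E; exact: Pstay.
(* The term of index 0 drops since [i < n]; the shift by one then matches the exponents [k.+1] of
   the bound. *)
have Pfe0 : P (first_exit m 0) = 0%E.
  rewrite /first_exit measureD//; last by rewrite ltey_eq fin_num_measure.
  rewrite (setIidr (@stay_anti m _ _ (leqnSn 0))) -(@subee _ 1%E)//.
  by congr (_ - _)%E; [exact: Pstay0|apply: etrans (Pstay 0%N) _; rewrite s0].
have int_term k : (\int[P]_w (rho m ^+ k * \1_(first_exit m k) w)%:E)%E =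
    ((rho m ^+ k)%:E * P (first_exit m k))%E.
  exact: integral_scaled_indic.
apply: (@le_trans _ _ (\int[P]_w \sum_(k <oo) (rho m ^+ k * \1_(first_exit m k) w)%:E)%E).
  apply: ge0_le_integral => //.
  - by move=> w _; exact: grid_sup_ge0.
  - apply: measurable_grid_sup; first exact: family_measurable.
    by rewrite /ext_measurable preimage_setC; apply: measurableC; exact: below_measurable.
  - exact: ge0_emeasurable_sum.
rewrite integral_nneseries//; under eq_eseriesr do rewrite int_term.
apply: lime_le; first by apply: is_cvg_nneseries => k _ _; rewrite mule_ge0 ?lee_fin.
apply: nearW => K; rewrite big_mkord; case: K => [|K].
  by rewrite big_ord0 lee_fin; have := Hc 0%N; rewrite big_ord0.
rewrite big_ord_recl/= Pfe0 mule0 add0e.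
have := Hc K; rewrite -lee_fin -sumEFin; apply: le_trans.
by apply: lee_sum => k _; rewrite Pfe EFinM.
Qed.

Let visit m k : set T := stay m k.+1 `&` [set w | Y (k.+1%:R * hm m) w = emb_state (Some n)].

(** Landing on [n] at the first exit is a visit to [n]. These events are disjoint in [k], so at most
    one term of the sum is nonzero on each path. *)
Lemma integral_dyadic_sup_ge m K :
  ((\sum_(k < K) rho m ^+ k.+1 * forward p (hm m) n i k.+1 (Some n))%:E <=
  \int[P]_w dyadic_sup Y [set emb_state (Some n)] w)%E.
Proof.
have mv k : measurable (visit m k).
  apply: measurableI => //.
  by apply: (chain_measurable_at (family_chain famY None)); rewrite mulr_ge0.
have rho0 k : 0 <= rho m ^+ k by rewrite exprn_ge0// expR_ge0.
have mterm k : measurable_fun setT (fun w => (rho m ^+ k.+1 * \1_(visit m k) w)%:E).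
  by apply/measurable_EFinP; apply: measurable_funM => //; exact: measurable_indic.
have term0 k w : (0 <= (rho m ^+ k.+1 * \1_(visit m k) w)%:E)%E.
  by rewrite lee_fin mulr_ge0// indicE.
have int_term k : (\int[P]_w (rho m ^+ k.+1 * \1_(visit m k) w)%:E)%E =
    (rho m ^+ k.+1 * forward p (hm m) n i k.+1 (Some n))%:E.
  rewrite integral_scaled_indic// EFinM; congr (_ * _)%E.
  exact: (stay_at_law famY n i (hm0 m)).
rewrite -sumEFin; under eq_bigr do rewrite -int_term.
rewrite -ge0_integral_sum//; apply: ge0_le_integral => //.
- by move=> w _; apply: sume_ge0 => k _.
- exact: emeasurable_sum.
- apply: measurable_dyadic_sup; first exact: family_measurable.
  exact: ext_measurable_state.
move=> w _; have [[k vk]|nov] := pselect (exists k : 'I_K, visit m k w).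
  rewrite (bigD1 k)//= big1 ?adde0; last first.
    move=> j jk; rewrite indicE memNset ?mulr0// => vj.
    have nb t : ~ (below n (Y t w) /\ Y t w = emb_state (Some n)).
      move=> [[l ln ->] /emb_state_inj [ln']]; by move: ln; rewrite ln' ltnn.
    case: (ltngtP j k) => [jk'|kj|/val_inj jk']; last by rewrite jk' eqxx in jk.
    - by apply: (nb (j.+1%:R * hm m)); split; [apply: vk.1|exact: vj.2].
    - by apply: (nb (k.+1%:R * hm m)); split; [apply: vj.1|exact: vk.2].
  apply: le_trans (le_dyadic_sup Y [set emb_state (Some n)] m k w).
  rewrite /discounted_visit expR_dyadic !indicE (mem_set vk) mem_set//.
  exact: vk.2.
rewrite big1 ?dyadic_sup_ge0// => k _; rewrite indicE memNset ?mulr0// => vk.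
by apply: nov; exists k.
Qed.

Lemma integral_dyadic_sup_exit :
  (\int[P]_w dyadic_sup Y (~` below n) w <= (g i / g n)%:E)%E.
Proof.
apply/lee_addgt0Pr => e e0; rewrite -EFinD.
have := near_right_dyadic (exit_bounds rates Hp Hs Hg i_n e0).
move=> H; apply: integral_dyadic_sup_le.
- exact: family_measurable.
- by rewrite /ext_measurable preimage_setC; apply: measurableC; exact: below_measurable.
apply: filterS H => m H; apply: integral_grid_sup_le => K.
by have [] := H K.
Qed.

Lemma integral_dyadic_sup_visit :
  ((g i / g n)%:E <= \int[P]_w dyadic_sup Y [set emb_state (Some n)] w)%E.
Proof.
apply/lee_subgt0Pr => e e0; rewrite -EFinB.
have e20 : 0 < e / 2 by rewrite divr_gt0.
(* The grid [m] is fixed first, then [K] makes the remainder [rho m ^+ K] small; each choice costs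
   [e / 2]. *)
have [m _ /(_ m (leqnn m)) H] := near_right_dyadic (exit_bounds rates Hp Hs Hg i_n e20).
have r1 : `|rho m| < 1.
  by rewrite gtr0_norm ?expR_gt0// -expR0 ltr_expR oppr_lt0 exprn_gt0.
have /cvgr0Pnorm_lt/(_ _ e20)[K _ /(_ K (leqnn K)) HK] := cvg_expr r1.
apply: le_trans (integral_dyadic_sup_ge m K); rewrite lee_fin.
have [lo _] := H K; apply: le_trans lo.
move: HK; rewrite /= ger0_norm ?exprn_ge0 ?expR_ge0//; lra.
Qed.

End level.
End first_visit.

(** An almost surely nonnegative difference with integral at most 0 vanishes almost surely; the
    bounds by 1 make the subtraction of integrals legitimate. *)
Lemma ae_eq_of_integral_squeeze {d} {T : measurableType d} {R : realType}
    (P : probability T R) (f g : T -> \bar R) (c : R) :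
  measurable_fun setT f -> measurable_fun setT g ->
  (forall x, (0 <= f x <= 1)%E) -> (forall x, (0 <= g x <= 1)%E) ->
  {ae P, forall x, (f x <= g x)%E} ->
  (c%:E <= \int[P]_x f x)%E -> (\int[P]_x g x <= c%:E)%E ->
  {ae P, forall x, f x = g x}.
Proof.
move=> mf mg f01 g01 fg cf gc.
have int01 h : measurable_fun setT h -> (forall x, (0 <= h x <= 1)%E) ->
    P.-integrable setT h.
  move=> mh h01; apply/integrableP; split => //.
  apply: (@le_lt_trans _ _ (\int[P]_x cst 1 x)%E); last first.
    rewrite integral_cst// mul1e; apply: le_lt_trans (ltry 1).
    exact: probability_le1.
  apply: ge0_le_integral => //; first exact: measurableT_comp.
  by move=> x _; have /andP[? ?] := h01 x; rewrite gee0_abs.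
have fint := int01 _ mf f01; have gint := int01 _ mg g01.
have ffin x : f x \is a fin_num.
  by have /andP[f0 f1] := f01 x; rewrite ge0_fin_numE// (le_lt_trans f1)// ltry.
have gfin x : g x \is a fin_num.
  by have /andP[f0 f1] := g01 x; rewrite ge0_fin_numE// (le_lt_trans f1)// ltry.
pose h x := (g x - f x)%E.
have mh : measurable_fun setT h by exact: emeasurable_funB.
have abs_eq : (\int[P]_x `|h x| = \int[P]_x h x)%E.
  apply: ae_eq_integral => //; first exact: measurableT_comp.
  by apply: filterS fg => x fgx _; rewrite gee0_abs// sube_ge0// ffin.
have int_fin k : P.-integrable setT k -> (\int[P]_x k x)%E \is a fin_num.
  by move=> ik; exact: integrable_fin_num.
have : (\int[P]_x `|h x| = 0)%E.
  apply/eqP; rewrite eq_le integral_ge0// andbT abs_eq integralB//.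
  have := le_trans gc cf; move: (int_fin _ fint) (int_fin _ gint).
  by case: (\int[P]_x f x)%E => // r _; case: (\int[P]_x g x)%E => // s _;
    rewrite -EFinB !lee_fin subr_le0.
move=> /(ae_eq_integral_abs _ measurableT mh); apply: filterS => x /= /(_ I).
move: (ffin x) (gfin x); rewrite /h; case: (f x) => // r _; case: (g x) => // s _.
by rewrite -EFinB => -[] /eqP; rewrite subr_eq0 => /eqP ->.
Qed.

Lemma expeR_ereal_inf_le {R : realType} (A : set (\bar R)) (y : \bar R) :
  (0 <= y)%E -> (forall x, A x -> expeR (- x) <= y)%E ->
  (expeR (- ereal_inf A) <= y)%E.
Proof.
move=> /expeR_total[z <-] H; rewrite lee_expeR leeNl.
by apply: le_ereal_inf_tmp => x Ax; rewrite leeNl -lee_expeR; exact: H.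
Qed.

Lemma expeR_ereal_sup_opp {R : realType} (u : (\bar R)^nat) :
  expeR (- ereal_sup (range u)) = ereal_inf (range (fun k => expeR (- u k))).
Proof.
apply/eqP; rewrite eq_le; apply/andP; split.
  apply: le_ereal_inf_tmp => _ [k _ <-]; rewrite lee_expeR leeN2.
  by apply: ereal_sup_ubound; exists k.
have e0 : (0 <= ereal_inf (range (fun k => expeR (- u k))))%E.
  by apply: le_ereal_inf_tmp => _ [k _ <-]; exact: expeR_ge0.
have [z zE] := expeR_total e0; rewrite -zE lee_expeR leeNr.
apply: ge_ereal_sup => _ [k _ <-]; rewrite leeNr -lee_expeR zE.
by apply: ereal_inf_lbound; exists k.
Qed.

(** * Hitting times and the flying time *)

Section flying.
Context {R : realType} (a b : nat -> R) (p : R -> nat -> nat -> R).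
Context {d} {T : measurableType d}.
Context (Px : option nat -> probability T R) (Y : R -> T -> ext_state R).
Hypothesis rates : birth_death_rates a b.
Hypothesis Hp : transition_matrix p.
Hypothesis Hs : standard p.
Hypothesis Hg : has_generator p (bd_matrix a b).
Hypothesis famY : canonical_family Px Y p.
Local Notation g := (bd_eigen a b).
Local Notation eta := (hitting_time Y).

Lemma below_closed n : ext_closed (@below R n).
Proof.
rewrite /ext_closed (_ : _ @^-1` _ = \bigcup_(j in `I_n) [set (j%:R : R)%:E]).
  by apply: closed_bigcup => //; move=> j _;
    exact/accessible_closed_set1/hausdorff_accessible/ereal_hausdorff.
apply/seteqP; split => x /=; first by move=> [j jn [->]]; exists j.
by move=> [j jn ->]; exists j.
Qed.

Lemma below_not n : ~ @below R n (emb_state (Some n)).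
Proof. by move=> [j jn /emb_state_inj [nj]]; move: jn; rewrite nj ltnn. Qed.

Lemma dyadic_dense : [set t : R | 0 <= t] `<=` closure (range (fun mk => dyadic mk.1 mk.2)).
Proof.
move=> t /= t0 B /nbhs_ballP[e /= e0 eB].
have /cvgr0Pnorm_lt/(_ _ e0)[m _ /(_ m (leqnn m)) Hm] := @half_expn_cvg R.
have := dyadic_next m t0; set k := Num.truncn _ => /andP[lo hi].
exists (dyadic m k); split; first by exists (m, k).
apply: eB; move: Hm; rewrite /ball/= !ltr_norml; lra.
Qed.

Lemma hitting_visit_le n w :
  (dyadic_sup Y [set emb_state (Some n)] w <= expeR (- eta n w))%E.
Proof.
apply: dyadic_sup_le => m k; rewrite /discounted_visit indicE.
case: (boolP (_ \in _)) => [/set_mem /= Yn|_]; last by rewrite mulr0 expeR_ge0.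
rewrite mulr1 -[leLHS]/(expeR (- (dyadic m k)%:E)) lee_expeR leeN2.
by apply: ereal_inf_lbound; exists (dyadic m k) => //=; rewrite dyadic_gt0.
Qed.

Lemma dyadic_range_countable : countable (range (fun mk => @dyadic R mk.1 mk.2)).
Proof. exact: sub_countable (card_image_le _ _) (countableP _). Qed.

(** If all dyadic times before [t + e] were spent in the closed set [below n], well-separability
    would put the path in it at time [t] too, where it is at [n]. The margin [e] is there because
    the interval is open and must contain [t]. *)
Lemma hitting_exit_le x :
  {ae Px x, forall w, forall n, (expeR (- eta n w) <= dyadic_sup Y (~` below n) w)%E}.
Proof.
have [_ [ws _ _]] := famY x.
have := ws _ dyadic_range_countable _ dyadic_dense.
have S0 : range (fun mk => @dyadic R mk.1 mk.2) `<=` [set t | 0 <= t].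
  by move=> _ [mk _ <-]; rewrite /= ltW// dyadic_gt0.
move=> /(_ S0); apply: filterS => w Hw n.
apply: expeR_ereal_inf_le; first exact: dyadic_sup_ge0.
move=> _ [t [t0 Yt] <-].
have [z zE] := expeR_total (dyadic_sup_ge0 Y (~` below n) w).
rewrite -zE lee_expeR leeNl; apply/lee_addgt0Pr => e e0.
have [[[m k] [s_lt out]]|none] := pselect (exists mk, dyadic mk.1 mk.2 < t + e /\
    ~ below n (Y (dyadic mk.1 mk.2) w)).
  rewrite -EFinD; apply: (@le_trans _ _ (dyadic m k)%:E); last by rewrite lee_fin ltW.
  rewrite leeNl -lee_expeR zE; apply: le_trans (le_dyadic_sup Y _ m k w).
  by rewrite /discounted_visit indicE mem_set// mulr1.
have := Hw 0 (t + e) (below n) (@below_closed n).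
have inside s : range (fun mk => @dyadic R mk.1 mk.2) s -> 0 < s < t + e -> below n (Y s w).
  move=> [mk _ <-] /andP[_ slt]; apply: contrapT => out.
  by apply: none; exists mk.
move=> /(_ inside t (ltW t0)); rewrite t0 ltrDl e0 Yt => /(_ isT).
by move=> /below_not.
Qed.

Lemma below_setC_measurable n : ext_measurable (~` @below R n).
Proof. by rewrite /ext_measurable preimage_setC; apply: measurableC; exact: below_measurable. Qed.

(** [expeR (- eta n w)] lies between the dyadic visit and exit variables, whose expectations squeeze
    them together at [g i / g n]. *)
Lemma hitting_ae i n : (i < n)%N ->
  {ae Px (Some i), forall w, expeR (- eta n w) = dyadic_sup Y (~` below n) w}.
Proof.
move=> i_n.
have dm B w : (0 <= dyadic_sup Y B w <= 1)%E.
  by rewrite dyadic_sup_ge0 dyadic_sup_le1.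
have ex := hitting_exit_le (Some i).
have le_ae : {ae Px (Some i), forall w, (dyadic_sup Y [set emb_state (Some n)] w <=
    dyadic_sup Y (~` below n) w)%E}.
  by apply: aeW => w; apply: le_dyadic_sup_set => x ->; exact: below_not.
have eq_ae : {ae Px (Some i), forall w, dyadic_sup Y [set emb_state (Some n)] w =
    dyadic_sup Y (~` below n) w}.
  apply: (ae_eq_of_integral_squeeze _ _ _ _ le_ae) => //.
  - by apply: measurable_dyadic_sup; [exact: family_measurable famY|exact: ext_measurable_state].
  - by apply: measurable_dyadic_sup; [exact: family_measurable famY|exact: below_setC_measurable].
  - exact: (integral_dyadic_sup_visit rates Hp Hs Hg famY i_n).
  - exact: (integral_dyadic_sup_exit rates Hp Hs Hg famY i_n).
apply: filterS2 ex eq_ae => w /(_ n) le1 eq1.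
by apply/eqP; rewrite eq_le le1 -eq1 hitting_visit_le.
Qed.

(** Levels start at [i.+1], above the starting point. Off a null set the exit variables decrease
    with the level, so the hitting times increase and the [lim] in [flying_time] is a true limit. *)
Lemma flying_ae i : {ae Px (Some i), forall w,
  expeR (- (1%:E * flying_time Y w)) =
  ereal_inf (range (fun k => dyadic_sup Y (~` below (k + i.+1)) w))}.
Proof.
have : {ae Px (Some i), forall w, forall k,
    expeR (- eta (k + i.+1) w) = dyadic_sup Y (~` below (k + i.+1)) w}.
  by apply: ae_foralln => k; apply: hitting_ae; rewrite addnS ltnS leq_addl.
apply: filterS => w Hw; rewrite mul1e.
have -> : flying_time Y w = ereal_sup (range (fun k => eta (k + i.+1) w)).
  apply/cvg_lim => //; rewrite -(cvg_shiftn i.+1).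
  apply: ereal_nondecreasing_cvgn => m n mn.
  rewrite -leeN2 -lee_expeR !Hw; apply: le_dyadic_sup_set.
  apply: subsetC => x [j jm ->]; exists j => //; apply: leq_trans jm _.
  by rewrite leq_add2r.
by rewrite expeR_ereal_sup_opp; congr ereal_inf; apply: eq_imagel => k _; exact: Hw.
Qed.

(** Dominated convergence, with bound 1, carries the value [g i / g n] to the limit of the levels;
    finiteness of sigma makes [limn g] a true limit. *)
Lemma u_fun_eigen i : (bd_sigma a b < +oo)%E ->
  u_fun Px Y 1 (Some i) = g i / limn g.
Proof.
move=> sfin; rewrite /u_fun.
pose xi k w := dyadic_sup Y (~` below (k + i.+1)) w.
have xi01 k w : (0 <= xi k w <= 1)%E by rewrite dyadic_sup_ge0 dyadic_sup_le1.
have mxi k : measurable_fun setT (xi k).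
  by apply: measurable_dyadic_sup; [exact: family_measurable famY|exact: below_setC_measurable].
have xicvg w : xi ^~ w @ \oo --> ereal_inf (range (xi ^~ w)).
  apply: ereal_nonincreasing_cvgn => m n mn; apply: le_dyadic_sup_set.
  apply: subsetC => x [j jm ->]; exists j => //; apply: leq_trans jm _.
  by rewrite leq_add2r.
have minf : measurable_fun setT (fun w => ereal_inf (range (xi ^~ w))).
  by apply: (emeasurable_fun_cvg xi) => // w _; exact: xicvg.
have inf0 w : (0 <= ereal_inf (range (xi ^~ w)))%E.
  by apply: le_ereal_inf_tmp => _ [k _ <-]; have /andP[] := xi01 k w.
rewrite (@ge0_ae_eq_integral_nonmeasurable _ _ _ _ _ (fun w => ereal_inf (range (xi ^~ w))))//; last 2 first.
- by move=> w; exact: expeR_ge0.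
- exact: flying_ae.
have int1 : (Px (Some i)).-integrable setT (cst 1%E : T -> \bar R).
  apply/integrableP; split => //.
  under eq_integral do rewrite gee0_abs//.
  by rewrite integral_cst// mul1e; apply: le_lt_trans (ltry 1); exact: probability_le1.
have aecvg : {ae Px (Some i), forall w, [set: T] w ->
    xi ^~ w @ \oo --> ereal_inf (range (xi ^~ w))}.
  by apply: aeW => w _; exact: xicvg.
have dom : {ae Px (Some i), forall w k, [set: T] w -> (`|xi k w| <= cst 1 w)%E}.
  by apply: aeW => w k _; have /andP[x0 x1] := xi01 k w; rewrite gee0_abs.
have [_ _ dc] := dominated_convergence measurableT mxi minf aecvg int1 dom.
have intxi k : (\int[Px (Some i)]_w xi k w)%E = (g i / g (k + i.+1)%N)%:E.
  have i_n : (i < k + i.+1)%N by rewrite addnS ltnS leq_addl.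
  apply/eqP; rewrite eq_le; apply/andP; split.
    exact: (integral_dyadic_sup_exit rates Hp Hs Hg famY i_n).
  apply: le_trans (integral_dyadic_sup_visit rates Hp Hs Hg famY i_n) _.
  apply: ge0_le_integral => //.
  - by move=> w _; exact: dyadic_sup_ge0.
  - by apply: measurable_dyadic_sup; [exact: family_measurable famY|exact: ext_measurable_state].
  - by move=> w _; apply: le_dyadic_sup_set => x ->; exact: below_not.
have gcvg := bd_eigen_cvg rates sfin.
have glim : 1 <= limn g.
  by apply: limr_ge => //; apply: nearW => k; exact: bd_eigen_ge1.
have gshift : (g i / g (k + i.+1)%N)%:E @[k --> \oo] --> (g i / limn g)%:E.
  apply/cvg_EFin; first exact: nearW.
  apply: cvgM; first exact: cvg_cst.
  apply: cvgV; first by rewrite gt_eqF// (lt_le_trans ltr01).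
  by rewrite (cvg_shiftn i.+1 g).
suff -> : (\int[Px (Some i)]_w ereal_inf (range (xi ^~ w)))%E = (g i / limn g)%:E by [].
rewrite -(cvg_lim (@ereal_hausdorff R) dc); apply/cvg_lim => //.
by apply: cvg_trans gshift; apply: near_eq_cvg; apply: nearW => k; rewrite /= intxi.
Qed.

End flying.

(** * The Ray cone and the compactification *)

Section convergent_cone.
Context {R : realType} (a b : nat -> R) (p : R -> nat -> nat -> R).
Context {d} {T : measurableType d}.
Context (Px : option nat -> probability T R) (Y : R -> T -> ext_state R).
Hypothesis rates : birth_death_rates a b.
Hypothesis sigma_fin : (bd_sigma a b < +oo)%E.
Hypothesis Hp : transition_matrix p.
Hypothesis Hs : standard p.
Hypothesis Hg : has_generator p (bd_matrix a b).
Hypothesis famY : canonical_family Px Y p.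
Local Notation g := (bd_eigen a b).

Definition convergent_at_infinity : set (option nat -> R) :=
  [set f | bounded_nonneg f /\ cvgn (fun i => f (Some i))].

(** The strict inequality is what keeps [u_fun] away from its limit 1 at every state. *)
Lemma bd_eigen_lt_lim i : g i < limn g.
Proof.
apply: lt_le_trans (bd_eigen_ltS rates i) _.
apply: nondecreasing_cvgn_le; last exact: bd_eigen_cvg.
by move=> m n mn; rewrite bd_eigen_increasing.
Qed.

Lemma u_fun_ge0 x : 0 <= u_fun Px Y 1 x.
Proof.
case: x => [i|]; last exact: lexx.
rewrite (u_fun_eigen rates Hp Hs Hg famY)// divr_ge0// ltW//; last first.
  exact: lt_trans (bd_eigen_lt_lim 0).
exact: bd_eigen_gt0.
Qed.

Lemma u_fun_lt1 x : u_fun Px Y 1 x < 1.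
Proof.
case: x => [i|]; last exact: ltr01.
have g0 : 0 < limn g by apply: lt_trans (bd_eigen_lt_lim 0); exact: bd_eigen_gt0.
by rewrite (u_fun_eigen rates Hp Hs Hg famY)// ltr_pdivrMr// mul1r bd_eigen_lt_lim.
Qed.

Lemma u_fun_cvg : u_fun Px Y 1 (Some i) @[i --> \oo] --> (1 : R).
Proof.
have g0 : 0 < limn g by apply: lt_trans (bd_eigen_lt_lim 0); exact: bd_eigen_gt0.
rewrite (_ : (fun i => _) = (fun i => g i / limn g)); last first.
  by apply/funext => i; rewrite (u_fun_eigen rates Hp Hs Hg famY).
rewrite -(divff (lt0r_neq0 g0)); apply: cvgM; last exact: cvg_cst.
exact: (bd_eigen_cvg rates).
Qed.

Let resolvent_in f alpha : 0 < alpha -> bounded_nonneg f ->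
  convergent_at_infinity (chain_resolvent Px Y alpha f).
Proof.
move=> a0 [f0 [M fM]]; split; last exact: (chain_resolvent_cvg rates Hp Hs Hg famY f0 fM).
split; first exact: (chain_resolvent_ge0 famY f0 fM).
exists (M / alpha) => x; rewrite ler_pdivlMr// mulrC.
exact: (chain_resolvent_le famY f0 fM).
Qed.

Lemma bounded_nonneg_indic (x : option nat) : bounded_nonneg (\1_[set x] : _ -> R).
Proof.
by split => [y|]; [|exists 1 => y]; have /andP[] := @indic_point_bounds R x y.
Qed.

Lemma eventually_cst_cvg (f : nat -> R) (c : R) N :
  (forall i, (N <= i)%N -> f i = c) -> f @ \oo --> c.
Proof. by move=> H; apply: cvg_near_cst; exists N => // i /= /H. Qed.

(* A countable dense family: [t.2] gives the first values on N, [t.1.2] the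
   limit at infinity and [t.1.1] the value at the cemetery. *)
Definition rational_step (t : rat * rat * seq rat) (x : option nat) : R :=
  if x is Some i then nth `|ratr t.1.2| [seq `|ratr q| | q <- t.2] i else `|ratr t.1.1|.

Lemma rational_step_convergent t : convergent_at_infinity (rational_step t).
Proof.
case: t => [[q0 q1] s]; split; last first.
  apply/cvg_ex; exists `|ratr q1|.
  apply: (@eventually_cst_cvg _ _ (size s)) => i si /=.
  by rewrite nth_default// size_map.
split => [[i|]|] /=; first last.
- exists (`|ratr q0| + `|ratr q1| + \sum_(q <- s) `|ratr q|) => -[i|] /=.
    have [si|si] := ltnP i (size s).
      rewrite (nth_map q0)//; apply: le_trans (_ : \sum_(q <- s) `|ratr q| <= _); last first.
        by rewrite lerDr addr_ge0.
      rewrite (big_nth q0) (bigD1_seq i) ?iota_uniq ?mem_iota ?subn0//=.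
      by rewrite lerDl sumr_ge0.
    rewrite nth_default ?size_map//.
    by rewrite -addrA addrC -addrA lerDl addr_ge0// sumr_ge0.
  by rewrite -addrA lerDl addr_ge0// sumr_ge0.
- exact: normr_ge0.
- have [si|si] := ltnP i (size s); last by rewrite nth_default ?size_map.
  by rewrite (nth_map q0).
Qed.

(** A rational just above [v] is its own absolute value; the absolute value keeps all approximants
    nonnegative. *)
Let rat_approx (v e : R) : 0 <= v -> 0 < e -> exists q : rat, `|v - `|ratr q| | <= e.
Proof.
move=> v0 e0; have [q] := @rat_in_itvoo _ v (v + e) (ltac:(by rewrite ltrDl)).
rewrite in_itv/= => /andP[lo hi]; exists q.
rewrite (ger0_norm (ltW (le_lt_trans v0 lo))) ler_norml; lra.
Qed.

Lemma convergent_cone_axioms : ray_cone_axioms (chain_resolvent Px Y)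
  (generating_family Px Y) convergent_at_infinity.
Proof.
split.
- by move=> f [].
- move=> c c' f h c0 c'0 [[f0 [M fM]] cf] [[h0 [N hN]] ch]; split; last first.
    by apply: is_cvgD; apply: is_cvgM => //; exact: is_cvg_cst.
  split => [x|]; first by rewrite addr_ge0// mulr_ge0.
  by exists (c * M + c' * N) => x; rewrite lerD// ler_wpM2l.
- split; last exact: is_cvg_cst.
  by split => //; exists 1.
- move=> f [[x ->]|->].
    exact/resolvent_in/bounded_nonneg_indic.
  split; last by apply/cvg_ex; exists 1; exact: u_fun_cvg.
  by split => [x|]; [exact: u_fun_ge0|exists 1 => x; exact/ltW/u_fun_lt1].
- exists (range rational_step); split.
  + exact: sub_countable (card_image_le _ _) (countableP _).
  + by move=> _ [t _ <-]; exact: rational_step_convergent.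
  + move=> f [[f0 [M fM]] cf] e e0.
    have e20 : 0 < e / 2 by rewrite divr_gt0.
    have lim0 : 0 <= limn (fun i => f (Some i)) by apply: limr_ge => //; exact: nearW.
    have /cvgrPdist_le/(_ _ e20)[N _ HN] := cf.
    have [q0 Hq0] := rat_approx (f0 None) e0.
    have [q1 Hq1] := rat_approx lim0 e20.
    have /choice[qs Hqs] : forall i, exists q : rat, `|f (Some i) - `|ratr q| | <= e.
      by move=> i; exact: rat_approx.
    (* From [N] on, [f] is within [e / 2] of its limit; beyond the list, the default value of [nth],
       given by [q1], serves the whole tail. *)
    exists (rational_step (q0, q1, map qs (iota 0 N))); first by exists (q0, q1, map qs (iota 0 N)).
    move=> [i|] //=; have [iN|Ni] := ltnP i N.
      by rewrite (nth_map 0) ?size_map ?size_iota// (nth_map 0%N) ?size_iota// nth_iota.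
    rewrite nth_default ?size_map ?size_iota//.
    have := HN i Ni; move: Hq1; rewrite !ler_norml/=; lra.
- move=> x y xy; exists (\1_[set x]); last first.
    rewrite !indicE mem_set// memNset ?oner_eq0// => yx.
    by move: xy; rewrite yx eqxx.
  split; first exact: bounded_nonneg_indic.
  apply/cvg_ex; exists 0.
  apply: (@eventually_cst_cvg _ _ (if x is Some j then j.+1 else 0%N)) => i.
  case: x {xy} => [j|] ji; rewrite indicE memNset//= => -[ij].
  by move: ji; rewrite ij ltnn.
- by move=> f alpha a0 [fb _]; exact: resolvent_in.
- move=> f h [[f0 [M fM]] cf] [[h0 [N hN]] ch]; split; last first.
    rewrite (_ : (fun i => _) = (fun i => (f (Some i) + h (Some i) - `|f (Some i) - h (Some i)|) / 2)).
      apply: is_cvgM; last exact: is_cvg_cst.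
      apply: is_cvgB; first exact: is_cvgD.
      by apply: is_cvg_norm; exact: is_cvgB.
    by apply/funext => i; rewrite minr_absE.
  split => [x|]; first by rewrite le_min f0 h0.
  by exists M => x; rewrite ge_min fM.
Qed.

End convergent_cone.

(** Each point is below all large [N]; compactness yields one [N] for the whole set. *)
Lemma compact_nat_finite (C : set nat) : compact C -> finite_set C.
Proof.
move=> /compact_near_coveringP/(_ nat \oo (fun N x => (x < N)%N)) [x _|N _ HN].
- exists ([set x], [set N | (x < N)%N]); last by move=> [y N] /= [-> xN].
  by split => //; exists x.+1.
- by apply: (sub_finite_set _ (finite_II N)) => x /(HN N (leqnn N)).
Qed.

(** * Topology of the compactification *)

Section compactification.
Context {R : realType} {F : pseudoPMetricType R} (e : option nat -> F).
Hypothesis hausF : hausdorff_space F.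
Hypothesis cptF : compact [set: F].
Hypothesis inj_e : injective e.
Hypothesis dense_e : dense (range e).
Hypothesis separate : forall x y : F, x != y ->
  exists2 f : F -> R, continuous f & f x != f y.
Hypothesis cvg_e : forall f : F -> R, continuous f -> cvgn (fun i => f (e (Some i))).
Variables (u : F -> R).
Hypothesis cont_u : continuous u.
Hypothesis u_cvg : u (e (Some i)) @[i --> \oo] --> (1 : R).
Hypothesis u_neq1 : forall x, u (e x) != 1.

Local Notation seq_e := (fun i => e (Some i)).

Let finite_closed (A : set F) : finite_set A -> closed A.
Proof.
by have /accessible_finite_set_closed := hausdorff_accessible hausF; apply.
Qed.

Let cluster_value z (f : F -> R) : continuous f -> cluster (seq_e @ \oo) z ->
  f z = limn (fun i => f (e (Some i))).
Proof.
move=> cf clz; set L := limn _.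
have fL := cvg_e cf; apply/eqP; rewrite -subr_eq0 -normr_eq0 eq_le normr_ge0 andbT.
apply/ler_addgt0Pl => eps eps0; rewrite addr0.
have e20 : 0 < eps / 2 by rewrite divr_gt0.
have near1 : nbhs (seq_e @ \oo) [set x | `|L - f x| <= eps / 2].
  by move/cvgrPdist_le : fL => /(_ _ e20).
have near2 : nbhs z [set x | `|f z - f x| <= eps / 2].
  by have /cvgrPdist_le/(_ _ e20) := cf z.
have [y [/= y1 y2]] := clz _ _ near1 near2.
by move: y1 y2; rewrite !ler_norml; lra.
Qed.

(** Continuous functions converge along the sequence, so they agree at any two of its cluster
    points; since they separate points, compactness leaves exactly one, which is the limit. *)
Lemma compactification_limit : exists z : F, seq_e @ \oo --> z.
Proof.
have [|z [_ clz]] := @cptF (seq_e @ \oo) _; first exact: filterT.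
exists z; apply: (compact_cluster_set1 hausF cptF); [exact: filterT|exact: filterT|].
apply/seteqP; split => [y cly|_ -> //].
apply: contrapT => yz; have [f cf /eqP] := separate (introN eqP yz).
by apply; rewrite !cluster_value.
Qed.

Section limit.
Variable z : F.
Hypothesis ez : seq_e @ \oo --> z.

Let uz : u z = 1.
Proof.
have uez : u (e (Some i)) @[i --> \oo] --> u z by apply: cvg_comp ez (cont_u (x:=z)).
exact: (cvg_unique _ uez u_cvg).
Qed.

Let e_neq x : e x != z.
Proof. by apply: contraNneq (u_neq1 x) => ->; rewrite uz. Qed.

(** A neighbourhood of [y] separated from [z] misses a tail of the sequence, hence contains finitely
    many states. Finite sets are closed, so these can be removed, and density leaves only [y];
    density again makes [y] a state. *)
Lemma compactification_isolated y : y != z -> open [set y] /\ range e y.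
Proof.
move=> yz; have := hausF; rewrite open_hausdorff => /(_ _ _ yz)[[V W] /= [yV zW] [oV oW /eqP VW]].
rewrite !inE in yV zW.
have [N _ HN] : \forall i \near \oo, W (e (Some i)).
  by apply: ez; exact: open_nbhs_nbhs.
pose A := [set e None] `|` (fun i => e (Some i)) @` `I_N.
have fA : finite_set A by rewrite finite_setU; split => //; exact: finite_image.
have VA x : V (e x) -> A (e x).
  case: x => [i|] Ve; last by left.
  have [iN|Ni] := ltnP i N; first by right; exists i.
  have : (V `&` W) (e (Some i)) by split => //; exact: HN.
  by rewrite VW.
have oO : open (V `\` (A `\ y)).
  by rewrite setDE; apply: openI => //; apply: closed_openC; apply: finite_closed; exact: finite_setD.
have oO' : open (V `\` A `\ y).
  rewrite setDE; apply: openI.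
    by rewrite setDE; apply: openI => //; apply: closed_openC; exact: finite_closed.
  apply: closed_openC; apply: finite_closed; exact: finite_set1.
(* Another point of [V] outside [A] would make the open set [oO'] nonempty; density would then give
   a state in [V] outside [A], against [VA]. *)
have eq1 : V `\` (A `\ y) = [set y].
  apply/seteqP; split => [x [Vx nA]|_ ->]; last by split => // -[_]; apply.
  apply: contrapT => xy.
  have : (V `\` A `\ y) x by split => //; split => // Ax; apply: nA.
  move=> Ox; have [//|w [[[Vw nAw] _] [x' _ xw]]] := @dense_e (V `\` A `\ y) _ oO'.
    by exists x.
  by apply: nAw; rewrite -xw; apply: VA; rewrite xw.
split; first by rewrite -eq1.
have : [set y] !=set0 by exists y.
rewrite -eq1 => ne; have [w [Ow [x _ xw]]] := @dense_e _ ne oO.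
by move: Ow; rewrite eq1 => <-; exists x.
Qed.

Lemma compactification_open_point x : open [set e x].
Proof. by have [] := compactification_isolated (e_neq x). Qed.

(** [None] has two roles: here it is the point at infinity, sent to [z], whereas [e None] is the
    cemetery. *)
Let phi (x : one_point_compactification nat) : F := if x is Some n then e (Some n) else z.

Lemma compactification_alexandroff : alexandroff_plus_cemetery e.
Proof.
exists phi; split => //.
- move=> [i|] [j|] //=; first by move/inj_e.
    by move/eqP; rewrite (negbTE (e_neq _)).
  by move/esym/eqP; rewrite (negbTE (e_neq _)).
- apply/seteqP; split => [_ [[i|] _ <-] /=|y ye].
  + by move/inj_e.
  + by move/esym/eqP; rewrite (negbTE (e_neq _)).
  + have [->|yz] := eqVneq y z; first by exists None.
    have [_ [[i|] _ iy]] := compactification_isolated yz; first by exists (Some i).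
    by exfalso; apply: ye; rewrite -iy.
- move=> U; split; rewrite !openE => oU x.
  + case: x => [i|] Ux.
      by apply/principal_filterP.
    have : (phi @` U)^° z by apply: oU; exists None.
    move=> /ez [N _ HN].
    (* Neighbourhoods of [None] contain complements of compact closed sets; the indices before the
       tail given by [ez] form such a set. *)
    exists `I_N; first by split; [exact: finite_compact|exact: discrete_closed].
    move=> y [[i /= iN <-]|->//].
    have Ni : (N <= i)%N by rewrite leqNgt; apply/negP.
    have [[j|] Uj /=] := HN i Ni; first by move/inj_e => [<-].
    by move/esym/eqP; rewrite (negbTE (e_neq _)).
  + move=> [y Uy <-]; have [yz|yz] := eqVneq (phi y) z; last first.
      have [openy _] := compactification_isolated yz.
      apply: (@filterS _ _ _ [set phi y]); first by move=> _ ->; exists y.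
      exact: open_nbhs_nbhs.
    have yN : y = None.
      by case: y Uy yz => // i _ /eqP; rewrite /= (negbTE (e_neq _)).
    have [C [cptC _] CU] : nbhs (None : one_point_compactification nat) U.
      by rewrite -yN; exact: oU.
    (* Finitely many indices mean a finite set [A] to remove, cemetery included, and its complement
       is an open neighbourhood of [z]. *)
    have finC : finite_set C by exact: compact_nat_finite.
    pose A := [set e None] `|` (fun i => e (Some i)) @` C.
    have fA : finite_set A by rewrite finite_setU; split => //; exact: finite_image.
    apply: (@filterS _ _ _ (~` A)); last first.
      apply: open_nbhs_nbhs; split.
        by apply: closed_openC; exact: finite_closed.
      by rewrite yz => -[/esym/eqP|[i _ /eqP]]; rewrite (negbTE (e_neq _)).
    * move=> y0 nAx; have [->|xz] := eqVneq y0 z.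
        by exists None => //; apply: CU; right.
      have [_ [[i|] _ ix]] := compactification_isolated xz.
        exists (Some i) => //; apply: CU; left; exists i => // Ci.
        by apply: nAx; right; exists i.
      by exfalso; apply: nAx; left.
- exact: compactification_open_point.
Qed.

End limit.
End compactification.

(** * Non-branching points and versions *)

Lemma continuous_borel_measurable {R : realType} {F : ptopologicalType} (f : F -> R) :
  continuous f -> measurable_fun setT (f : borelType F -> R).
Proof.
move=> cf mD; apply: (measurability _ (RGenOInfty.measurableE R)) => //.
move=> _ [_ [x ->] <-]; rewrite setTI; apply: sub_sigma_algebra.
by move/continuousP : cf => /(_ `]x, +oo[%classic); apply; exact: interval_open.
Qed.

Section nonbranching_points.
Context {R : realType} {F : pseudoPMetricType R} (Rbar : R -> R.-fker (borelType F) ~> (borelType F)).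
Hypothesis hausF : hausdorff_space F.
Hypothesis cptF : compact [set: F].
Hypothesis submarkov : forall alpha (x : borelType F), 0 < alpha -> (alpha%:E * Rbar alpha x setT <= 1)%E.

Lemma borel_point (x : F) : measurable ([set x] : set (borelType F)).
Proof.
rewrite -[X in measurable X]setCK; apply: measurableC; apply: sub_sigma_algebra.
by apply: closed_openC; exact/accessible_closed_set1/hausdorff_accessible.
Qed.

(** The measure [alpha * Rbar alpha x] has total mass at most 1 and puts mass tending to 1 on [x],
    so all other points together contribute at most [M * (1 - alpha * r alpha)]. *)
Lemma nonbranching_of_resolvent (x : F) (r : R -> R) :
  (forall alpha, 0 < alpha -> Rbar alpha x [set x] = (r alpha)%:E) ->
  alpha * r alpha @[alpha --> +oo] --> (1 : R) -> nonbranching Rbar x.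
Proof.
move=> Rx rcvg f cf.
have mf := continuous_borel_measurable cf.
have [M M0 fM] : exists2 M : R, 0 < M & forall y, `|f y| <= M.
  have cptf : compact (f @` setT) by apply: continuous_compact => //; exact: continuous_subspaceT.
  have [M1 [_ HM]] := compact_bounded cptf.
  exists (`|M1| + 1) => [|y]; first by rewrite ltr_wpDl.
  by apply: (HM (`|M1| + 1)); [rewrite (le_lt_trans (ler_norm _))// ltrDl|exists y].
apply/cvgrPdist_le => eps eps0.
(* Two errors remain at the end, each at most [M * (eps / (4 * M)) = eps / 4]. *)
have d0 : 0 < eps / (4 * M) by rewrite divr_gt0// mulr_gt0.
have /cvgrPdist_le/(_ _ d0) nearr := rcvg.
near=> alpha.
have a0 : 0 < alpha by near: alpha; exact: nbhs_pinfty_gt.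
have nr : `|1 - alpha * r alpha| <= eps / (4 * M) by near: alpha.
pose mu : {measure set (borelType F) -> \bar R} := Rbar alpha x.
have mx := borel_point x.
have mux : mu [set x] = (r alpha)%:E by exact: Rx.
have [m muT am] : exists2 m, mu setT = m%:E & alpha * m <= 1.
  have sub1 : (alpha%:E * mu setT <= 1)%E by exact: submarkov.
  have mu0 : (0 <= mu setT)%E by exact: measure_ge0.
  move: sub1 mu0; case: (mu setT) => [m sub1 _|sub1 _|//].
    by exists m => //; rewrite -lee_fin EFinM.
  by move: sub1; rewrite gt0_muley.
have muC : mu (~` [set x]) = (m - r alpha)%:E.
  have -> : mu (~` [set x]) = (mu setT - mu (setT `&` [set x]))%E.
    have muy : (mu setT < +oo)%E by rewrite muT ltry.
    by rewrite -setTD; apply: measureD.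
  by rewrite setTI muT mux.
have split_ : (\int[mu]_y (f y)%:E = \int[mu]_(y in [set x]) (f y)%:E +
    \int[mu]_(y in ~` [set x]) (f y)%:E)%E.
  rewrite -(setUv [set x]) integral_setU_EFin//.
  - exact: measurableC.
  - exact: measurable_funTS.
  - by apply/disj_set2P; rewrite setICr.
have intx : (\int[mu]_(y in [set x]) (f y)%:E = (f x * r alpha)%:E)%E.
  rewrite (eq_integral (cst (f x)%:E)); last by move=> y; rewrite inE => ->.
  by rewrite integral_cst// mux EFinM.
have intC : (`|\int[mu]_(y in ~` [set x]) (f y)%:E| <= (M * (m - r alpha))%:E)%E.
  apply: le_trans (le_abse_integral _ _ _) _; first exact: measurableC.
    by apply/measurable_EFinP; exact: measurable_funTS.
  rewrite EFinM -muC -integral_cst; last exact: measurableC.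
  apply: ge0_le_integral => //; first exact: measurableC.
    by apply: measurableT_comp => //; apply/measurable_EFinP; exact: measurable_funTS.
  by move=> y _; rewrite /= lee_fin.
have [J [JE JM]] : exists J, kint (Rbar alpha) f x = f x * r alpha + J /\
    `|J| <= M * (m - r alpha).
  rewrite /kint /Rintegral -/mu split_ intx.
  move: intC; case: (\int[mu]_(y in ~` [set x]) _)%E => [J| |]//=.
  by rewrite lee_fin => JM; exists J.
rewrite JE.
have MJ : alpha * `|J| <= M * (1 - alpha * r alpha).
  apply: le_trans (ler_wpM2l (ltW a0) JM) _.
  by rewrite mulrCA ler_wpM2l ?(ltW M0)// mulrBr lerD2r.
have -> : f x - alpha * (f x * r alpha + J) = f x * (1 - alpha * r alpha) - alpha * J by ring.
apply: le_trans (ler_normB _ _) _.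
rewrite normrM [`|alpha * J|]normrM (gtr0_norm a0).
have H1 : `|f x| * `|1 - alpha * r alpha| <= M * (eps / (4 * M)).
  by apply: ler_pM.
have H2 : M * (1 - alpha * r alpha) <= M * (eps / (4 * M)).
  by rewrite ler_pM2l//; apply: le_trans (ler_norm _) nr.
have H3 : M * (eps / (4 * M)) = eps / 4 by field; rewrite gt_eqF.
lra.
Unshelve. all: by end_near. Qed.

End nonbranching_points.

Lemma cvg_right_bounds {R : realType} (s r : nat -> R) (t : R) :
  (forall n, t < s n <= t + r n) -> r @ \oo --> (0 : R) -> s @ \oo --> t^'+.
Proof.
move=> sr r0 A nA; have : \forall x \near t^'+, A x by [].
rewrite /at_right near_withinE => /nbhs_ballP[e /= e0 eA].
move/cvgr0Pnorm_lt : r0 => /(_ _ e0); apply: filterS => n rn.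
have /andP[ts sn] := sr n; apply: eA => //.
move: rn; rewrite /ball/= !ltr_norml; lra.
Qed.

Lemma probability_negligible_setC {d} {T : measurableType d} {R : realType}
    (P : probability T R) (A : set T) : measurable A ->
  P.-negligible (~` A) <-> P A = 1%E.
Proof.
move=> mA; split => [[N [mN N0 AN]]|A1]; last first.
  by exists (~` A); split => //; [exact: measurableC|rewrite probability_setC// A1 subee].
have : P (~` A) = 0%E by apply: (subset_measure0 _ mN AN N0); exact: measurableC.
rewrite probability_setC//.
have := probability_le1 P mA; have := measure_ge0 P A.
case: (P A) => [r| |]// _ _.
by rewrite -EFinB => -[] /eqP; rewrite subr_eq0 => /eqP <-.
Qed.

(** * Agreement at every fixed time *)

Section version.
Context {R : realType} {d} {T : measurableType d} {F : pseudoPMetricType R}.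
Context (p : R -> nat -> nat -> R) (P : probability T R) (X : R -> T -> ext_state R).
Context (init : option nat -> \bar R) (e : option nat -> F) (Xbar : R -> T -> F).
Hypothesis Hp : transition_matrix p.
Hypothesis Hs : standard p.
Hypothesis HX : markov_chain P X p init.
Hypothesis hausF : hausdorff_space F.
Hypothesis mXbar : forall t, 0 <= t -> measurable_fun setT (Xbar t : T -> borelType F).
Hypothesis cadlagX : forall w, cadlag (fun t => Xbar t w).
Hypothesis version : {ae (@lebesgue_measure R), forall t, 0 <= t ->
  P (coincide e X Xbar t) = 1%E}.

Let agree t x := [set w | X t w = emb_state x] `&` Xbar t @^-1` [set e x].

Let magree t x : 0 <= t -> measurable (agree t x).
Proof.
move=> t0; apply: measurableI; first exact: (chain_measurable_at HX).
by rewrite -[X in measurable X]setTI; apply: mXbar => //; exact: borel_point.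
Qed.

Lemma coincideE t : coincide e X Xbar t = \bigcup_k agree t (state_of_nat k).
Proof.
apply/seteqP; split => [w [x Xx Xbx]|w [k _ [Xk Xbk]]].
  by have [k kx] := state_of_nat_surj x; exists k => //; rewrite kx.
by exists (state_of_nat k).
Qed.

Lemma coincide_measurable t : 0 <= t -> measurable (coincide e X Xbar t).
Proof. by move=> t0; rewrite coincideE; apply: bigcup_measurable => k _; exact: magree. Qed.

(** An interval of positive length is not negligible, hence contains a time of agreement. *)
Lemma version_dense t delta : 0 <= t -> 0 < delta ->
  exists2 s, t < s < t + delta & P (coincide e X Xbar s) = 1%E.
Proof.
move=> t0 d0; apply: contrapT => none.
have [N [mN N0 HN]] := version.
have sub : `]t, (t + delta)[%classic `<=` N.
  move=> s /=; rewrite in_itv/= => /andP[ts sd]; apply: HN => /= H.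
  apply: none; exists s; first by rewrite ts.
  by apply: H; rewrite (le_trans t0)// ltW.
have : lebesgue_measure (`]t, (t + delta)[%classic : set R) = 0%E.
  by apply: (subset_measure0 _ mN sub N0); exact: measurable_itv.
rewrite lebesgue_measure_itv/= lte_fin ltrDl d0 -EFinB addrAC subrr add0r.
by move=> [] /eqP; rewrite gt_eqF.
Qed.

Lemma coincide_always t : 0 <= t -> P (coincide e X Xbar t) = 1%E.
Proof.
move=> t0.
have /choice[s Hs'] : forall n, exists s, t < s < t + 2^-1 ^+ n /\ P (coincide e X Xbar s) = 1%E.
  move=> n; have [|s] := @version_dense t (2^-1 ^+ n) t0; first by rewrite exprn_gt0.
  by exists s.
have s_cvg : s @ \oo --> t^'+.
  apply: cvg_right_bounds half_expn_cvg => n.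
  by have [/andP[-> /ltW ->]] := Hs' n.
have s0 n : 0 <= s n by have [/andP[/ltW ts _] _] := Hs' n; exact: le_trans ts.
have null1 n : P.-negligible (~` coincide e X Xbar (s n)).
  apply/probability_negligible_setC; last exact: (proj2 (Hs' n)).
  exact: coincide_measurable.
(* On [X t = x], almost surely the chain is again at [x] at some [s n] with [n >= N]: missing a
   single late [s n] already has probability at most [1 - h (s n - t) x x], which tends to 0. Asking
   for infinitely many returns avoids the choice of a subsequence. *)
have null2 x N : P.-negligible ([set w | X t w = emb_state x] `\`
    \bigcup_(n in [set n | (N <= n)%N]) [set w | X (s n) w = emb_state x]).
  have mA := chain_measurable_at HX x t0.
  have mB n : measurable [set w | X (s n) w = emb_state x] by exact: (chain_measurable_at HX).
  have mU : measurable (\bigcup_(n in [set n | (N <= n)%N]) [set w | X (s n) w = emb_state x]).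
    by apply: bigcup_measurable => n _.
  apply/negligibleP; first exact: measurableD.
  apply/eqP; rewrite eq_le measure_ge0 andbT.
  apply/lee_addgt0Pr => eps eps0; rewrite add0e.
  have := honest_diag_cvg Hs x; move/cvgrPdist_le/(_ _ eps0) => nearh.
  have : \forall n \near \oo, `|1 - honest_ext p (s n - t) x x| <= eps.
    have : s n - t @[n --> \oo] --> 0^'+.
      apply: cvg_right_bounds half_expn_cvg => n.
      by have [/andP[? /ltW ?] _] := Hs' n; rewrite subr_gt0 add0r lerBlDl; apply/andP.
    by move=> sc; exact: (sc _ nearh).
  move=> [K _ HK]; pose n := maxn N K.
  apply: (@le_trans _ _ (P ([set w | X t w = emb_state x] `\` [set w | X (s n) w = emb_state x]))).
    apply: le_measure; rewrite ?inE; [exact: measurableD|exact: measurableD|].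
    by apply: setDS => w Xw; exists n => //=; rewrite leq_maxl.
  rewrite measureD//; last by rewrite ltey_eq fin_num_measure.
  have st : 0 <= s n - t by have [/andP[/ltW ts _] _] := Hs' n; rewrite subr_ge0.
  have := chain_two_times HX Hp x x t0 st; rewrite addrC subrK => two.
  have hn := HK n (leq_maxr _ _).
  suff : (P [set w | X t w = emb_state x] -
    P [set w | X t w = emb_state x /\ X (s n) w = emb_state x] <= eps%:E)%E by [].
  have [q Pq] : exists q, P [set w | X t w = emb_state x] = q%:E.
    by exists (fine (P [set w | X t w = emb_state x])); rewrite fineK ?fin_num_measure.
  have q0 : 0 <= q by rewrite -lee_fin -Pq measure_ge0.
  have := probability_le1 P mA; rewrite two Pq -EFinM -EFinB !lee_fin => q1.
  apply: le_trans hn; rewrite -[X in X - _]mulr1 -mulrBr.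
  apply: (@le_trans _ _ (q * `|1 - honest_ext p (s n - t) x x|)).
    by apply: ler_wpM2l => //; exact: ler_norm.
  by rewrite ler_piMl.
(* At the returns of the chain to [x] the Ray process is at [e x]. If it were elsewhere at [t],
   right continuity would keep it off the closed point [e x] at all late [s n]. *)
have null3 x : P.-negligible ([set w | X t w = emb_state x] `\` agree t x).
  have nB : P.-negligible (\bigcup_n (~` coincide e X Xbar (s n)) `|`
    \bigcup_N ([set w | X t w = emb_state x] `\`
    \bigcup_(n in [set n | (N <= n)%N]) [set w | X (s n) w = emb_state x])).
    by apply: negligibleU; exact: negligible_bigcup.
  apply: negligibleS nB => w [Xw nag]; apply: contrapT => /not_orP[n1 n2].
  apply: nag; split => //=; apply: contrapT => Xbw.
  have opn : open (~` [set e x]).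
    by apply: closed_openC; exact/accessible_closed_set1/hausdorff_accessible.
  have [N _ HN] : \forall n \near \oo, Xbar (s n) w <> e x.
    have near_t : \forall r \near t^'+, (~` [set e x]) (Xbar r w).
      have [rc _] := cadlagX w.
      exact: (rc t t0 _ (open_nbhs_nbhs (conj opn Xbw))).
    exact: (s_cvg _ near_t).
  have : (\bigcup_(n in [set n | (N <= n)%N]) [set w | X (s n) w = emb_state x]) w.
    by apply: contrapT => nU; apply: n2; exists N.
  move=> [n /= Nn Xn]; apply: (HN n Nn).
  have [y Xy ->] : coincide e X Xbar (s n) w.
    by apply: contrapT => nc; apply: n1; exists n.
  by congr e; apply: (@emb_state_inj R); rewrite -Xn.
have : P.-negligible (~` coincide e X Xbar t).
  have nB : P.-negligible (~` [set w | exists k, X t w = emb_state k] `|`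
    \bigcup_k ([set w | X t w = emb_state (state_of_nat k)] `\` agree t (state_of_nat k))).
    apply: negligibleU; last exact: negligible_bigcup.
    apply/probability_negligible_setC; last exact: (chain_states HX).
    exact: (chain_measurable_states HX).
  apply: negligibleS nB => w nc; have [[x Xx]|] := pselect (exists k, X t w = emb_state k); last by left.
  right; have [k kx] := state_of_nat_surj x; exists k => //; rewrite kx; split => //.
  by move=> [_ Xb]; apply: nc; exists x.
by move/(probability_negligible_setC _ (coincide_measurable t0)).
Qed.

End version.

(** * Agreement at almost every time along a path *)

Section almost_every_time.
Context {R : realType} {d} {T : measurableType d} {F : pseudoPMetricType R}.
Context (P : probability T R) (X : R -> T -> ext_state R).
Context (e : option nat -> F) (Xbar : R -> T -> F).
Hypothesis mX : borel_process X.
Hypothesis hausF : hausdorff_space F.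
Hypothesis open_e : forall x, open [set e x].
Hypothesis mXbar : forall t, 0 <= t -> measurable_fun setT (Xbar t : T -> borelType F).
Hypothesis cadlagX : forall w, cadlag (fun t => Xbar t w).
Hypothesis coincide1 : forall t, 0 <= t -> P (coincide e X Xbar t) = 1%E.
Local Notation leb := (@lebesgue_measure R).

Let grid n (t : R) : R := dyadic n (Num.truncn (t / 2^-1 ^+ n)).

Let grid_cvg t : 0 <= t -> grid n t @[n --> \oo] --> t^'+.
Proof. by move=> t0; apply: cvg_right_bounds half_expn_cvg => n; exact: dyadic_next. Qed.

Let at_point x : set (measurableTypeR R * T) :=
  [set tw | 0 <= tw.1 /\ Xbar tw.1 tw.2 = e x].

Let grid_at_point n x : set (measurableTypeR R * T) :=
  [set tw | 0 <= tw.1 /\ Xbar (grid n tw.1) tw.2 = e x].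

(** [grid n] is constant on each dyadic interval, so the set is a countable union of rectangles. *)
Let grid_at_point_measurable n x : measurable (grid_at_point n x).
Proof.
have h0 : 0 < (2^-1 : R) ^+ n by rewrite exprn_gt0.
rewrite (_ : grid_at_point n x = \bigcup_k
   (`[k%:R * 2^-1 ^+ n, k.+1%:R * 2^-1 ^+ n[%classic `*` (Xbar (dyadic n k) @^-1` [set e x]))).
  apply: bigcup_measurable => k _; apply: measurableX; first exact: measurable_itv.
  rewrite -[X in measurable X]setTI; apply: mXbar => //; last exact: borel_point.
  exact/ltW/dyadic_gt0.
apply/seteqP; split => -[t w] /=.
  move=> [t0 Xt]; exists (Num.truncn (t / 2^-1 ^+ n)) => //; split => //=.
  have y0 : 0 <= t / 2^-1 ^+ n by rewrite divr_ge0// ltW.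
  have /andP[lo hi] := truncn_itv y0.
  by rewrite in_itv/= -ler_pdivlMr// lo -ltr_pdivrMr.
move=> [k _ [/=]]; rewrite in_itv/= => /andP[lo hi] Xt.
have t0 : 0 <= t by apply: le_trans lo; rewrite mulr_ge0// ltW.
split => //; rewrite /grid (_ : Num.truncn _ = k)//.
by apply/truncn_def; rewrite ler_pdivlMr// ltr_pdivrMr// lo.
Qed.

(** The singleton of [e x] is both open and closed, so by right continuity the Ray process is at
    [e x] at time [t] exactly when it is there at all late grid times following [t]. This gives
    joint measurability. *)
Let at_point_measurable x : measurable (at_point x).
Proof.
have mD : measurable (\bigcup_N \bigcap_(n in [set n | (N <= n)%N]) grid_at_point n x).
  by apply: bigcup_measurable => N _; apply: bigcap_measurableType => n _.
rewrite (_ : at_point x = \bigcup_N \bigcap_(n in [set n | (N <= n)%N]) grid_at_point n x)//.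
have right_cont w t (A : set F) : 0 <= t -> open A -> A (Xbar t w) ->
    \forall n \near \oo, A (Xbar (grid n t) w).
  move=> t0 oA At; have [rc _] := cadlagX w.
  have near_t : \forall r \near t^'+, A (Xbar r w).
    exact: (rc t t0 _ (open_nbhs_nbhs (conj oA At))).
  exact: (grid_cvg t0 near_t).
apply/seteqP; split => -[t w] /=.
  move=> [t0 Xt]; have [N _ HN] := right_cont w t [set e x] t0 (open_e x) Xt.
  by exists N => // n /= Nn; split => //; exact: HN.
move=> [N _ HN]; have [t0 _] := HN N (leqnn N).
split => //; apply: contrapT => nXt.
have opn : open (~` [set e x]).
  by apply: closed_openC; exact/accessible_closed_set1/hausdorff_accessible.
have [M _ HM] := right_cont w t _ t0 opn nXt.
apply: (HM (maxn N M)); first by rewrite /= leq_maxr.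
by have [] := HN (maxn N M) (leq_maxl _ _).
Qed.

Let agreement : set (measurableTypeR R * T) :=
  [set tw | 0 <= tw.1 /\ coincide e X Xbar tw.1 tw.2].

Let agreement_measurable : measurable agreement.
Proof.
rewrite (_ : agreement = \bigcup_k (([set tw : R * T | 0 <= tw.1] `&`
    (fun tw => X tw.1 tw.2) @^-1` [set emb_state (state_of_nat k)]) `&` at_point (state_of_nat k))).
  apply: bigcup_measurable => k _; apply: measurableI => //.
  exact: (mX (ext_measurable_state (state_of_nat k))).
apply/seteqP; split => -[t w] /=.
  move=> [t0 [x Xx Xbx]]; have [k kx] := state_of_nat_surj x.
  by exists k => //; rewrite kx.
by move=> [k _ [[t0 Xt] [_ Xbt]]]; split => //; exists (state_of_nat k).
Qed.

Let disagreement : set (measurableTypeR R * T) :=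
  (`[0%R, +oo[%classic `*` setT) `\` agreement.

Let disagreement_measurable : measurable disagreement.
Proof. by apply: measurableD => //; apply: measurableX. Qed.

Lemma coincide_almost_every_time :
  {ae P, forall w, {ae leb, forall t, 0 <= t -> coincide e X Xbar t w}}.
Proof.
pose f (tw : measurableTypeR R * T) : \bar R := (\1_disagreement tw)%:E.
have mf : measurable_fun setT f by apply/measurable_EFinP; exact: measurable_indic.
have f0 tw : (0 <= f tw)%E by rewrite lee_fin indicE.
have mxs t : measurable (xsection disagreement t) by exact: measurable_xsection.
have mys w : measurable (ysection disagreement w) by exact: measurable_ysection.
have intT t : (\int[P]_w f (t, w) = 0)%E.
  have -> : (\int[P]_w f (t, w) = P (xsection disagreement t))%E.
    rewrite -[in RHS](setIT (xsection _ _)) -integral_indic//.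
    by apply: eq_integral => w _; rewrite /f !indicE mem_xsection.
  have [t0|t0] := leP 0 t; last first.
    rewrite (_ : xsection _ _ = set0) ?measure0//.
    apply/seteqP; split => // w; rewrite /xsection/= inE => -[[/=]].
    by rewrite in_itv/= andbT leNgt t0.
  rewrite (_ : xsection _ _ = ~` coincide e X Xbar t); last first.
    apply/seteqP; split => w; rewrite /xsection/= inE.
      by move=> [_ nag] ct; apply: nag.
    by move=> nc; split; [split => //=; rewrite in_itv/= t0|case].
  have mc : measurable (coincide e X Xbar t).
    rewrite (_ : coincide e X Xbar t = xsection agreement t); first exact: measurable_xsection.
    by apply/seteqP; split => w; rewrite /xsection/= inE; [split|case].
  by rewrite probability_setC// coincide1// subee.
have intW : (\int[P]_w \int[leb]_t f (t, w) = 0)%E.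
  have /= <- := fubini_tonelli (m1 := leb) (m2 := P) f mf f0.
  by under eq_integral do rewrite intT; rewrite integral0.
have mG := measurable_fun_fubini_tonelli_G (m1 := leb) f mf f0.
have G0 w : (0 <= \int[leb]_t f (t, w))%E by apply: integral_ge0.
have : (\int[P]_w `|\int[leb]_t f (t, w)| = 0)%E.
  by rewrite -intW; apply: eq_integral => w _; rewrite gee0_abs.
move=> /(ae_eq_integral_abs _ measurableT mG); apply: filterS => w /= /(_ I).
rewrite /fubini_G => Iw.
exists (ysection disagreement w); split => //.
  rewrite -Iw -[in LHS](setIT (ysection _ _)) -integral_indic//.
  by apply: eq_integral => t _; rewrite /f !indicE mem_ysection.
move=> t /= /not_implyP[t0 nc]; rewrite /ysection/= inE.
by split; [split => //=; rewrite in_itv/= t0|case].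
Qed.

End almost_every_time.

Theorem lemma4p4 (R : realType)
  (a b : nat -> R) (rates : birth_death_rates a b)
  (regular_or_exit : infty_regular a b \/ infty_exit a b)
  (p : R -> nat -> nat -> R)
  (d : measure_display) (T : measurableType d) (P : probability T R)
  (X : R -> T -> ext_state R)
  (QX : Q_process (bd_matrix a b) p P X) (mX : borel_process X)
  (d' : measure_display) (T' : measurableType d')
  (Px : option nat -> probability T' R) (Y : R -> T' -> ext_state R)
  (famY : canonical_family Px Y p)
  (S : set (option nat -> R))
  (rayS : is_ray_cone (chain_resolvent Px Y) (generating_family Px Y) S)
  (F : pseudoPMetricType R) (e : option nat -> F)
  (Rbar : R -> R.-fker (borelType F) ~> (borelType F)) (Xbar : R -> T -> F)
  (RK : ray_knight (chain_resolvent Px Y) S P X e Rbar Xbar) :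
  [/\ forall t, 0 <= t -> P (coincide e X Xbar t) = 1%E,
      range e `<=` nonbranching Rbar,
      {ae P, forall w, {ae (@lebesgue_measure R), forall t, 0 <= t ->
         coincide e X Xbar t w}} &
      alexandroff_plus_cemetery e].
Proof.
have sfin : (bd_sigma a b < +oo)%E by case: regular_or_exit => -[].
have [Hp Hs Hg [nu HX]] := QX.
have [hausF cptF inj_e dense_e _ ray extend diff_dense resolvE [mXbar cadX _] version] := RK.
have [coneS minS] := rayS.
have SC := minS _ (convergent_cone_axioms rates sfin Hp Hs Hg famY).
have part1 : forall t, 0 <= t -> P (coincide e X Xbar t) = 1%E.
  by move=> t t0; apply: (coincide_always Hp Hs HX hausF mXbar cadX version).
have part2 : range e `<=` nonbranching Rbar.
  move=> _ [x _ <-].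
  apply: (nonbranching_of_resolvent hausF cptF (rr_submarkov ray)
    (r := fun alpha => chain_resolvent Px Y alpha (\1_[set x]) x)).
    by move=> alpha a0; rewrite -resolvE// image_set1.
  exact: (chain_resolvent_point_cvg Hp Hs Hg famY).
have Su : S (u_fun Px Y 1) by apply: (rc_gen coneS); right.
have [u [[cu ue] _]] := extend _ Su.
have separate : forall x y : F, x != y -> exists2 f : F -> R, continuous f & f x != f y.
  by move=> x y /(rr_points ray)[f [cf _ fxy]]; exists f.
have cvg_e : forall f : F -> R, continuous f -> cvgn (fun i => f (e (Some i))).
  (* Up to [eps / 2], [f] is a difference of functions from the cone, which converge along the
     states; hence the Cauchy property. *)
  move=> f cf; apply/cauchy_cvgP/cauchy_exP => eps eps0.
  have e20 : 0 < eps / 2 by rewrite divr_gt0.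
  have [g [h [[cg Sg] [ch Sh] fgh]]] := diff_dense f cf _ e20.
  have [_ cvg_g] := SC _ Sg; have [_ cvg_h] := SC _ Sh.
  exists (limn (fun i => (g \o e) (Some i)) - limn (fun i => (h \o e) (Some i))).
  have /cvgrPdist_lt/(_ _ e20) : (fun i => (g \o e) (Some i) - (h \o e) (Some i)) @ \oo -->
    limn (fun i => (g \o e) (Some i)) - limn (fun i => (h \o e) (Some i)) by exact: cvgB.
  apply: filterS => i; rewrite /ball/= => H.
  have := fgh (e (Some i)); move: H; rewrite !ltr_norml; lra.
have u_cvg : u (e (Some i)) @[i --> \oo] --> (1 : R).
  under eq_fun do rewrite ue; exact: (u_fun_cvg rates sfin Hp Hs Hg famY).
have u_neq1 x : u (e x) != 1.
  by rewrite ue lt_eqF// (u_fun_lt1 rates sfin Hp Hs Hg famY).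
have [z ez] := compactification_limit hausF cptF separate cvg_e.
have open_e := compactification_open_point hausF dense_e cu u_cvg u_neq1 ez.
split => //.
- exact: (coincide_almost_every_time mX hausF open_e mXbar cadX part1).
- exact: (compactification_alexandroff hausF inj_e dense_e cu u_cvg u_neq1 ez).
Qed.
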